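(* Let $0<\alpha<2$. A real, measurable, stationary S$\alpha$S random field $\{X_t\}_{t\in\mathbb T^d}$ is ergodic if and only if it is weakly mixing.
   Context: $\mathbb T\in\{\mathbb Z,\mathbb R\}$; $\lambda$ counting or Lebesgue measure on $\mathbb T^d$; $B(T)=(-T,T]^d\cap\mathbb T^d$, $C(T)=(2T)^d$; $\|t\|=\max_i|t_i|$. Write $X_t=X_0\circ\theta_t$ with $\{\theta_t\}$ a measure-preserving $\mathbb T^d$-action on $(\Omega,\mathcal F,\mathbb P)$, $\sigma_X=\sigma(X_t:t\in\mathbb T^d)$. Ergodic: $\lim_T\frac1{C(T)}\int_{B(T)}\mathbb P(A\cap\theta_t(B))\lambda(dt)=\mathbb P(A)\mathbb P(B)$ for all $A,B\in\sigma_X$. A set $E\subset\mathbb T^d$ has density zero if $\lim_T\frac1{C(T)}\int_{B(T)}\mathbf 1_E\,d\lambda=0$; $D$ has density one if $\mathbb T^d\setminus D$ has density zero; $\mathcal T_D$ is the set of sequences $(t_n)\subset D$ with $\|t_n\|\to\infty$. Weakly mixing: there is a density-one set $D$ with $\lim_n\mathbb P(A\cap\theta_{t_n}(B))=\mathbb P(A)\mathbb P(B)$ for all $A,B\in\sigma_X$ and all $(t_n)\in\mathcal T_D$. *)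

(* Defs.v *)
From HB Require Import structures.
From mathcomp Require Import all_boot all_order all_algebra.
From mathcomp Require Import all_classical all_reals all_analysis.
Set Implicit Arguments. Unset Strict Implicit. Unset Printing Implicit Defensive.
Import Order.TTheory GRing.Theory Num.Theory.
Import numFieldNormedType.Exports.
Local Open Scope classical_set_scope.
Local Open Scope ring_scope.

Section Defs.
Variable R : realType.

Definition isInt (x : R) : Prop := exists k : int, x = k%:~R.
Definition Tset (disc : bool) (d : nat) : set 'rV[R]_d :=
  if disc then [set t | forall i, isInt (t ord0 i)] else setT.

Definition supnorm (d : nat) (t : 'rV[R]_d) : R :=
  \big[Num.max/0]_(i < d) `|t ord0 i|.

(* one-dimensional integral over (-T,T] w.r.t. lambda:
   counting measure on Z, or Lebesgue measure on R *)
Definition int1 (disc : bool) (T : R) (g : R -> \bar R) : \bar R :=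
  if disc then
    (\sum_(0 <= j < `|Num.floor T - Num.floor (- T)|%N)
        g ((Num.floor (- T) + 1 + (j%:Z))%:~R))%E
  else (\int[lebesgue_measure]_(x in [set` `]- T, T]%R]) g x)%E.

Fixpoint iint (disc : bool) (T : R) (n : nat) (f : (nat -> R) -> \bar R)
  : \bar R :=
  match n with
  | 0 => f (fun _ => 0)
  | n'.+1 => int1 disc T (fun x =>
               iint disc T n' (fun g => f (fun k => if k == n' then x else g k)))
  end.

(* \int_{B(T)} f d(lambda), B(T) = (-T,T]^d cap T^d, as an iterated
   integral (all integrands used below are nonnegative, so by Tonelli this
   is the integral w.r.t. the product measure lambda on T^d) *)
Definition lamint (disc : bool) (d : nat) (T : R) (f : 'rV[R]_d -> \bar R)
  : \bar R := iint disc T d (fun g => f (\row_(i < d) g (nat_of_ord i))).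

Definition lamavg (disc : bool) (d : nat) (T : R) (f : 'rV[R]_d -> \bar R)
  : \bar R := (GRing.exp (2 * T) d)^-1%:E * lamint disc T f.

Definition rVborel (d : nat) : set (set 'rV[R]_d) :=
  smallest (sigma_algebra setT)
    [set [set t : 'rV[R]_d | forall i, B i (t ord0 i)] | B in
       [set B : 'I_d -> set R | forall i, measurable (B i)]].

Definition density_zero (disc : bool) (d : nat) (E : set 'rV[R]_d) : Prop :=
  lamavg disc T (fun t => (\1_E t)%:E) @[T --> +oo] --> 0%E.

Definition density_one (disc : bool) (d : nat) (D : set 'rV[R]_d) : Prop :=
  density_zero disc (@Tset disc d `\` D).

Context {dO : measure_display} {Omega : measurableType dO}.

(* sigma_X = sigma(X_t : t in T^d), X_t = X0 o theta_t *)
Definition sigmaX (disc : bool) (d : nat) (X0 : Omega -> R)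
  (theta : 'rV[R]_d -> Omega -> Omega) : set (set Omega) :=
  smallest (sigma_algebra setT)
    [set (X0 \o theta t) @^-1` B | t in @Tset disc d & B in
       [set B : set R | measurable B]].

Definition mp_action (disc : bool) (d : nat) (P : probability Omega R)
  (theta : 'rV[R]_d -> Omega -> Omega) : Prop :=
  [/\ theta 0 = id,
      (forall s t, @Tset disc d s -> @Tset disc d t ->
         theta (s + t) = theta s \o theta t),
      (forall t, @Tset disc d t -> measurable_fun setT (theta t)) &
      (forall t A, @Tset disc d t -> measurable A ->
         P (theta t @^-1` A) = P A)].

(* real symmetric alpha-stable random field: every finite linear
   combination Y = sum_j a_j X_{t_j} has characteristic function
   E exp(i u Y) = exp(-sigma^alpha |u|^alpha) for some sigma >= 0
   (written through its real and imaginary parts) *)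
Definition SaS_field (alpha : R) (disc : bool) (d : nat)
  (P : probability Omega R) (X0 : Omega -> R)
  (theta : 'rV[R]_d -> Omega -> Omega) : Prop :=
  measurable_fun setT X0 /\
  forall (n : nat) (a : 'I_n -> R) (t : 'I_n -> 'rV[R]_d),
    (forall j, @Tset disc d (t j)) ->
    let Y := fun w => \sum_(j < n) a j * X0 (theta (t j) w) in
    exists2 sigma : R, 0 <= sigma &
      forall u : R,
        (\int[P]_w (cos (u * Y w))%:E = (expR (- (sigma `^ alpha * `|u| `^ alpha)))%:E)%E
        /\ (\int[P]_w (sin (u * Y w))%:E = 0)%E.

Definition measurable_field (d : nat) (X0 : Omega -> R)
  (theta : 'rV[R]_d -> Omega -> Omega) : Prop :=
  forall B : set R, measurable B ->
    smallest (sigma_algebra setT)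
      [set [set p : 'rV[R]_d * Omega | A p.1 /\ F p.2] | A in @rVborel d &
         F in [set F : set Omega | measurable F]]
      ((fun p : 'rV[R]_d * Omega => X0 (theta p.1 p.2)) @^-1` B).

Definition ergodic (disc : bool) (d : nat) (P : probability Omega R)
  (X0 : Omega -> R) (theta : 'rV[R]_d -> Omega -> Omega) : Prop :=
  forall A B, sigmaX disc X0 theta A -> sigmaX disc X0 theta B ->
    lamavg disc T (fun t => P (A `&` (theta t @` B))) @[T --> +oo]
      --> (P A * P B)%E.

Definition weakly_mixing (disc : bool) (d : nat) (P : probability Omega R)
  (X0 : Omega -> R) (theta : 'rV[R]_d -> Omega -> Omega) : Prop :=
  exists D : set 'rV[R]_d,
    [/\ D `<=` @Tset disc d, @rVborel d D, density_one disc D &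
      forall A B, sigmaX disc X0 theta A -> sigmaX disc X0 theta B ->
      forall tn : nat -> 'rV[R]_d, (forall n, D (tn n)) ->
        (fun n => supnorm (tn n)) @ \oo --> +oo ->
        (fun n => P (A `&` (theta (tn n) @` B))) @ \oo --> (P A * P B)%E].

End Defs.

(* Main.v *)
(** The stability trick behind the nontrivial direction: for linear combinations
    [Y1], [Y2] of the field, [Z_t = E cos (Y1 o theta_(-t) - Y2) = exp (- s_t)], and
    rescaling both by [2^(1/alpha)] replaces [Z_t] by [Z_t^2] and the limit
    [c = E cos Y1 * E cos Y2] by [c^2].  Ergodicity thus says that the averages of
    [Z_t] and [Z_t^2] tend to [c] and [c^2], so the averages of [(Z_t - c)^2], hence
    of [|Z_t - c|], tend to [0].  Trigonometric polynomials in the field form an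
    algebra whose L1-closure contains the indicators of [sigma_X], so
    [|P (A & theta_t B) - P A * P B|] averages to [0] for all [A], [B] in [sigma_X].
    Joint measurability makes [sigma_X] part of a countably generated sigma-algebra,
    so countably many pairs [(A, B)] suffice, and the Koopman-von Neumann argument
    yields a single density-one set for all of them. *)
Require Import Defs.
From HB Require Import structures.
From mathcomp Require Import all_boot all_order all_algebra.
From mathcomp Require Import all_classical all_reals all_analysis.
From mathcomp Require Import measurable_realfun lra ring zify.
Import Order.TTheory GRing.Theory Num.Theory.
Import numFieldNormedType.Exports.
Local Open Scope classical_set_scope.
Local Open Scope ring_scope.
Set Implicit Arguments. Unset Strict Implicit. Unset Printing Implicit Defensive.

(** * Iterated integrals *)

Section IteratedIntegral.
Variable R : realType.
Implicit Types (disc : bool) (T x : R) (n : nat).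

(** Ergodicity controls averages of signed correlations, which may cancel, while weak mixing needs
    their absolute values to average to [0]; some identity special to the field has to exclude
    cancellation. It is available because the difference of [Y1 o theta_(-t)] and [Y2] is again a
    linear combination of the field, so one real characteristic function describes the pair. This
    confines the identity to sines and cosines of linear combinations, and all other functions must
    be reached by L1 approximation uniform in [t]. Real functions suffice: symmetry gives
    [E sin = 0] and makes the mixed sine-cosine correlations vanish.

    The set [D] may depend neither on [A] nor on [B], which is why separability of [sigma_X] is
    needed. Over [R^d] it comes from joint measurability, over [Z^d] from the countability of time;
    accordingly measurability in [t] is required only under [~~ disc].

    For the converse, mixing along [D] says nothing about times off [D] or near the origin. The
    former have density zero by assumption, the latter because [d > 0]. *)

Definition coord_system : set (set (nat -> R)) :=
  [set (fun g : nat -> R => g k) @^-1` B | k in [set: nat]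
     & B in [set B : set R | measurable B]].

Local Notation RN := (g_sigma_algebraType coord_system).

Lemma measurable_coord k : measurable_fun [set: RN] (fun g : RN => g k).
Proof.
move=> _ B mB; rewrite setTI; apply: sub_sigma_algebra.
by exists k => //; exists B.
Qed.

Lemma measurable_fun_coord d (U : measurableType d) (f : U -> RN) :
  (forall k, measurable_fun setT (fun u => f u k)) -> measurable_fun setT f.
Proof.
move=> mf; apply: (@measurability _ _ U RN _ _ coord_system) => //.
by move=> _ [_ [k _ [B mB <-]] <-]; rewrite setTI -[X in measurable X]setTI; exact: mf.
Qed.

(** Convertible to the function that [iint] builds when it fixes coordinate [n], so passing between
    the two costs nothing. *)
Definition upd n x (g : nat -> R) : nat -> R := fun k => if k == n then x else g k.

Lemma measurable_upd d (U : measurableType d) n (a : U -> R) (f : U -> RN) :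
  measurable_fun setT a -> measurable_fun setT f ->
  measurable_fun setT (fun u => upd n (a u) (f u) : RN).
Proof.
move=> ma mf; apply: measurable_fun_coord => k; rewrite /upd.
case: (k == n) => //.
exact: (measurableT_comp (measurable_coord k) mf).
Qed.

(** The parameter space [U] is general because the induction moves the outermost variable into it:
    the hypothesis is applied over [U * R], and Tonelli then integrates the real coordinate out. *)
Lemma measurable_iint T n d (U : measurableType d) (f : U * RN -> \bar R) :
  measurable_fun setT f -> (forall p, (0 <= f p)%E) ->
  measurable_fun setT (fun u => iint false T n (fun g => f (u, g))).
Proof.
elim: n d U f => [|n IH] d U f mf f0 /=.
  exact: (measurable_fun_pair1 ((fun=> 0) : RN) mf).
pose F (p : U * R) := iint false T n (fun g => f (p.1, upd n p.2 g)).
have iint0 m (h : (nat -> R) -> \bar R) :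
    (forall g, (0 <= h g)%E) -> (0 <= iint false T m h)%E.
  elim: m h => [|m IHm] h h0 //=.
  by apply: integral_ge0 => x _; exact: IHm.
have mF : measurable_fun setT F.
  have mupd : measurable_fun setT
      (fun q : (U * R) * RN => (q.1.1, upd n q.1.2 q.2 : RN)).
    apply: measurable_fun_pair; first exact: (measurableT_comp measurable_fst).
    apply: measurable_upd => //; exact: (measurableT_comp measurable_snd).
  have := IH _ _ _ (measurableT_comp mf mupd) (fun=> f0 _).
  exact.
(* Tonelli is applied on the whole line, so the interval becomes an indicator factor. *)
pose I := [set` `]- T, T]%R] : set R.
have -> : (fun u => (\int[lebesgue_measure]_(x in [set` `]- T, T]%R])
    iint false T n (fun g => f (u, fun k => if k == n then x else g k)))%E) =
  fubini_F lebesgue_measure (fun p => F p * (\1_I p.2)%:E)%E.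
  apply/funext => u; rewrite /fubini_F [LHS]integral_mkcond; apply: eq_integral => x _.
  by rewrite epatch_indic.
apply: measurable_fun_fubini_tonelli_F.
  apply: emeasurable_funM => //; apply/measurable_EFinP.
  apply: measurableT_comp => //; apply: (@measurable_indic _ _ R setT I).
  exact: measurable_itv.
by move=> p; apply: mule_ge0; [exact: iint0|rewrite lee_fin].
Qed.

Definition box disc T x : Prop := - T < x <= T /\ (disc -> isInt x).

Lemma int1_ge0 disc T (g : R -> \bar R) :
  (forall x, 0 <= g x)%E -> (0 <= int1 disc T g)%E.
Proof.
move=> g0; rewrite /int1; case: disc; last exact: integral_ge0.
exact: sume_ge0.
Qed.

Lemma le_int1 disc T (f g : R -> \bar R) : 0 < T ->
  (~~ disc -> measurable_fun setT f) -> (~~ disc -> measurable_fun setT g) ->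
  (forall x, 0 <= f x)%E ->
  (forall x, box disc T x -> (f x <= g x)%E) ->
  (int1 disc T f <= int1 disc T g)%E.
Proof.
move=> T0 mf mg f0 fg; rewrite /int1; case: disc mf mg fg => mf mg fg; last first.
  apply: ge0_le_integral => //.
  - by apply: measurable_funTS; exact: mf.
  - by apply: measurable_funTS; exact: mg.
  - by move=> x /=; rewrite in_itv/= => xT; exact: fg.
(* The points [floor (- T) + 1 + j] stay in [(-T, T]]: the shift by [1] excludes [-T], and [0 < T]
   makes the number of terms the plain difference of the floors. *)
rewrite !big_mkord; apply: lee_sum => j _; apply: fg; split; last by eexists.
have fT : Num.floor (- T) <= Num.floor T.
  by apply: le_floor; rewrite (le_trans _ (ltW T0))// oppr_le0 ltW.
apply/andP; split.
  apply: (lt_le_trans (floorD1_gt (- T))).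
  by rewrite ler_int lerDl.
rewrite -floor_ge_int.
have := ltn_ord j; rewrite -ltz_nat gez0_abs ?subr_ge0//.
by move: (Num.floor (- T)) (Num.floor T) (j : nat) => a b k; lia.
Qed.

Lemma int1D disc T (f g : R -> \bar R) :
  (~~ disc -> measurable_fun setT f) -> (~~ disc -> measurable_fun setT g) ->
  (forall x, 0 <= f x)%E -> (forall x, 0 <= g x)%E ->
  (int1 disc T (fun x => f x + g x) = int1 disc T f + int1 disc T g)%E.
Proof.
move=> mf mg f0 g0; rewrite /int1; case: disc mf mg => mf mg; first exact: big_split.
by rewrite ge0_integralD//; apply: measurable_funTS; [exact: mf|exact: mg].
Qed.

Lemma int1Z disc T (c : R) (f : R -> \bar R) :
  0 <= c -> (~~ disc -> measurable_fun setT f) -> (forall x, 0 <= f x)%E ->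
  (int1 disc T (fun x => c%:E * f x) = c%:E * int1 disc T f)%E.
Proof.
move=> c0 mf f0; rewrite /int1; case: disc mf => mf.
  by rewrite ge0_sume_distrr.
by rewrite ge0_integralZl//; apply: measurable_funTS; exact: mf.
Qed.

(** Integrands on which [iint] is monotone and additive. A counting integral over a box is a finite
    sum, hence measurability is asked only for Lebesgue measure. *)
Definition iadm disc (f : (nat -> R) -> \bar R) : Prop :=
  (forall g, 0 <= f g)%E /\ (~~ disc -> measurable_fun [set: RN] f).

Lemma iadm_upd disc n x f : iadm disc f -> iadm disc (fun g => f (upd n x g)).
Proof.
move=> [f0 mf]; split=> // /mf {}mf.
exact: (measurableT_comp mf
  (measurable_upd n (measurable_cst x) (@measurable_id _ RN setT))).
Qed.

Lemma iint_ge0 disc T n f : iadm disc f -> (0 <= iint disc T n f)%E.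
Proof.
elim: n f => [|n IH] f af /=; first exact: af.1.
by apply: int1_ge0 => x; apply: IH; exact: iadm_upd.
Qed.

Lemma measurable_iint_upd disc T n f : iadm disc f ->
  ~~ disc -> measurable_fun setT (fun x => iint disc T n (fun g => f (upd n x g))).
Proof.
case: disc => // -[f0 /(_ erefl) mf] _.
have mupd : measurable_fun setT (fun p : R * RN => upd n p.1 p.2 : RN).
  exact: (measurable_upd n measurable_fst measurable_snd).
exact: (measurable_iint T n (measurableT_comp mf mupd) (fun=> f0 _)).
Qed.

Lemma le_iint disc T n f f' : 0 < T -> iadm disc f -> iadm disc f' ->
  (forall g, (forall k, (k < n)%N -> box disc T (g k)) -> (f g <= f' g)%E) ->
  (iint disc T n f <= iint disc T n f')%E.
Proof.
move=> T0; elim: n f f' => [|n IH] f f' af af' ff' /=; first exact: ff'.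
apply: le_int1 => //; [exact: measurable_iint_upd|exact: measurable_iint_upd| |].
  by move=> x; apply: iint_ge0; exact: iadm_upd.
move=> x bx; apply: IH; [exact: iadm_upd|exact: iadm_upd|].
move=> g bg; apply: ff' => k; rewrite ltnS leq_eqVlt.
by case: eqP => //= _; exact: bg.
Qed.

Lemma iintD disc T n f f' : iadm disc f -> iadm disc f' ->
  (iint disc T n (fun g => f g + f' g) = iint disc T n f + iint disc T n f')%E.
Proof.
elim: n f f' => [|n IH] f f' af af' //=.
rewrite -int1D; first (congr int1; apply/funext => x; rewrite -IH//; exact: iadm_upd).
- exact: measurable_iint_upd.
- exact: measurable_iint_upd.
- by move=> x; apply: iint_ge0; exact: iadm_upd.
- by move=> x; apply: iint_ge0; exact: iadm_upd.
Qed.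

Lemma iintZ disc T n (c : R) f : 0 <= c -> iadm disc f ->
  (iint disc T n (fun g => c%:E * f g) = c%:E * iint disc T n f)%E.
Proof.
move=> c0; elim: n f => [|n IH] f af //=.
rewrite -int1Z//; first (congr int1; apply/funext => x; rewrite -IH//; exact: iadm_upd).
- exact: measurable_iint_upd.
- by move=> x; apply: iint_ge0; exact: iadm_upd.
Qed.

Definition len1 disc T : R :=
  if disc then `|Num.floor T - Num.floor (- T)|%N%:R else 2 * T.

Lemma len1_ge0 disc T : 0 <= T -> 0 <= len1 disc T.
Proof. by rewrite /len1; case: disc => // T0; rewrite mulr_ge0. Qed.

Lemma int1_cst disc T (c : R) : 0 <= T ->
  int1 disc T (fun=> c%:E) = (c * len1 disc T)%:E.
Proof.
move=> T0; rewrite /int1 /len1; case: disc.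
  by rewrite big_mkord sumEFin sumr_const card_ord mulr_natr.
rewrite integral_cst//= lebesgue_measure_itv/= lte_fin EFinM; congr (_ * _)%E.
have [//|] := ltP (- T) T; first by rewrite -EFinB opprK -mulr2n mulr_natl.
by move=> TT; congr EFin; lra.
Qed.

Lemma iint_cst disc T n (c : R) : 0 <= T ->
  iint disc T n (fun=> c%:E) = (c * len1 disc T ^+ n)%:E.
Proof.
move=> T0; elim: n => [|n IH] /=; first by rewrite expr0 mulr1.
by rewrite IH int1_cst// exprSr mulrA.
Qed.

(** Coordinate [n] is the outermost variable of [iint] on [n.+1] coordinates, so a function of it
    alone leaves a constant under the [n] inner integrals. *)
Lemma iint_last disc T n (phi : R -> \bar R) : 0 <= T ->
  (forall x, 0 <= phi x)%E -> (~~ disc -> measurable_fun setT phi) ->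
  (forall x, phi x \is a fin_num) ->
  iint disc T n.+1 (fun g => phi (g n)) =
  ((len1 disc T ^+ n)%:E * int1 disc T phi)%E.
Proof.
move=> T0 phi0 mphi phifin /=; rewrite -int1Z// ?exprn_ge0 ?len1_ge0//.
congr int1; apply/funext => x; rewrite eqxx -(fineK (phifin x)) iint_cst//.
by rewrite -EFinM mulrC.
Qed.

End IteratedIntegral.

(** * Averages over boxes *)

Section Mean.
Variables (R : realType) (disc : bool) (d : nat).
Implicit Types (T c : R) (h k : 'rV[R]_d -> R) (t : 'rV[R]_d).

(** Generator of [rVborel], named so that the Borel sets become the measurable sets of a measurable
    type. *)
Definition rects : set (set 'rV[R]_d) :=
  [set [set t : 'rV[R]_d | forall i, B i (t ord0 i)] | B in
     [set B : 'I_d -> set R | forall i, measurable (B i)]].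

Local Notation RN := (g_sigma_algebraType (@coord_system R)).
Local Notation Bor := (g_sigma_algebraType rects).
Local Notation TT := (@Tset R disc d).

Definition row_of (g : nat -> R) : 'rV[R]_d := \row_(i < d) g i.

Lemma measurable_entry i : measurable_fun setT (fun t : Bor => t ord0 i : R).
Proof.
move=> _ B mB; rewrite setTI; apply: sub_sigma_algebra.
exists (fun j => if j == i then B else setT) => [j|]; first by case: ifP.
apply/seteqP; split => t /= => [/(_ i)|Bt j]; first by rewrite eqxx.
by case: eqP => // ->.
Qed.

Lemma measurable_fun_entry dU (U : measurableType dU) (f : U -> Bor) :
  (forall i, measurable_fun setT (fun u => f u ord0 i : R)) -> measurable_fun setT f.
Proof.
move=> mf; apply: (@measurability _ _ U Bor _ _ rects) => //.
move=> _ [_ [B mB <-] <-]; rewrite setTI.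
have -> : f @^-1` [set t : 'rV[R]_d | forall i, B i (t ord0 i)] =
    \bigcap_(i in [set: 'I_d]) ((fun u => f u ord0 i) @^-1` B i).
  by apply/seteqP; split => u /= => [fu i _|fu i]; exact: fu.
apply: fin_bigcap_measurable => // i _.
by rewrite -[X in measurable X]setTI; exact: mf.
Qed.

Lemma measurable_row_of : measurable_fun setT (row_of : RN -> Bor).
Proof.
apply: measurable_fun_entry => i.
apply: (eq_measurable_fun (fun g : RN => g i : R)) (measurable_coord i).
by move=> g _; rewrite mxE.
Qed.

(** Boundedness is asked on [T^d] only, since values elsewhere never enter a box; in the Lebesgue
    case [T^d] is the whole space. *)
Definition adm h : Prop :=
  (exists M, forall t, TT t -> `|h t| <= M) /\ (~~ disc -> measurable_fun setT (h : Bor -> R)).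

Definition nadm h : Prop := adm h /\ forall t, 0 <= h t.

Lemma supnorm_entry t i : `|t ord0 i| <= supnorm t.
Proof. by rewrite /supnorm; exact: (le_bigmax_cond _ (fun i => `|t ord0 i|)). Qed.

Lemma supnorm_le t M : 0 <= M -> (forall i, `|t ord0 i| <= M) -> supnorm t <= M.
Proof. by move=> M0 tM; apply/bigmax_leP; split. Qed.

Lemma box_row T (g : nat -> R) : 0 <= T ->
  (forall j, (j < d)%N -> box disc T (g j)) -> TT (row_of g) /\ supnorm (row_of g) <= T.
Proof.
move=> T0 bg; split.
  rewrite /Tset; case: (disc) bg => //= bg i; rewrite mxE.
  by have [_ /(_ erefl)] := bg i (ltn_ord i).
apply: supnorm_le => // i; rewrite mxE.
have [/andP[gT gT'] _] := bg i (ltn_ord i).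
by rewrite ler_norml (ltW gT).
Qed.

Lemma nadm_iadm h : nadm h -> iadm disc (fun g => (h (row_of g))%:E).
Proof.
move=> [[_ mh] h0]; split=> [g|/mh {}mh]; first by rewrite lee_fin.
apply/measurable_EFinP; exact: (measurableT_comp mh measurable_row_of).
Qed.

Definition Lint T h : R := fine (lamint disc T (fun t => (h t)%:E)).

Lemma nadm_cst c : 0 <= c -> nadm (fun=> c).
Proof.
by move=> c0; do !split => //; exists `|c|.
Qed.

Lemma lamint_cst T c : 0 <= T ->
  lamint disc T (fun _ : 'rV[R]_d => c%:E) = (c * len1 disc T ^+ d)%:E.
Proof. by move=> T0; rewrite /lamint iint_cst. Qed.

Lemma lamint_fin T h : 0 < T -> nadm h ->
  lamint disc T (fun t => (h t)%:E) = (Lint T h)%:E.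
Proof.
move=> T0 ah; rewrite /Lint fineK// ge0_fin_numE; last first.
  by apply: iint_ge0; exact: nadm_iadm.
have [[[M hM] _] h0] := ah.
have M0 : 0 <= Num.max M 0 by rewrite le_max lexx orbT.
apply: (@le_lt_trans _ _ (lamint disc T (fun _ : 'rV[R]_d => (Num.max M 0)%:E))).
  apply: le_iint => //; first exact: nadm_iadm.
  move=> g bg; rewrite lee_fin.
  have [tg _] := box_row (ltW T0) bg.
  by rewrite le_max (le_trans (ler_norm _) (hM _ tg)).
by rewrite lamint_cst ?ltW// ltry.
Qed.

Lemma Lint_le T h k : 0 < T -> nadm h -> nadm k ->
  (forall t, TT t -> supnorm t <= T -> h t <= k t) -> Lint T h <= Lint T k.
Proof.
move=> T0 ah ak hk; rewrite -lee_fin -!lamint_fin//.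
apply: le_iint => //; [exact: nadm_iadm|exact: nadm_iadm|].
by move=> g bg; have [? ?] := box_row (ltW T0) bg; rewrite lee_fin hk.
Qed.

Lemma Lint_eq T h k : 0 < T -> nadm h -> nadm k ->
  (forall t, TT t -> supnorm t <= T -> h t = k t) -> Lint T h = Lint T k.
Proof.
move=> T0 ah ak hk; apply/eqP; rewrite eq_le; apply/andP.
by split; apply: Lint_le => // t *; rewrite hk.
Qed.

Lemma admD h k : adm h -> adm k -> adm (fun t => h t + k t).
Proof.
move=> [[M hM] mh] [[N kN] mk]; split; last first.
  by move=> nd; exact: (measurable_funD (mh nd) (mk nd)).
exists (M + N) => t Tt; apply: (le_trans (ler_normD _ _)).
by apply: lerD; [exact: hM|exact: kN].
Qed.

Lemma admZ c h : adm h -> adm (fun t => c * h t).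
Proof.
move=> [[M hM] mh]; split; last first.
  by move=> nd; apply: measurable_funM => //; exact: mh.
by exists (`|c| * M) => t Tt; rewrite normrM ler_wpM2l// hM.
Qed.

Lemma admN h : adm h -> adm (fun t => - h t).
Proof.
by move=> /(@admZ (-1)); under [in X in X -> _]eq_fun do rewrite mulN1r.
Qed.

Lemma adm_cst c : adm (fun=> c).
Proof. by split=> //; exists `|c|. Qed.

Lemma adm_norm h : adm h -> adm (fun t => `|h t|).
Proof.
move=> [[M hM] mh]; split; first by exists M => t; rewrite normr_id; exact: hM.
by move=> nd; apply: measurableT_comp => //; exact: mh.
Qed.

Lemma adm_max0 h : adm h -> nadm (fun t => Num.max (h t) 0).
Proof.
move=> [[M hM] mh]; split; last by move=> t; rewrite le_max lexx orbT.
split; last by move=> nd; apply: measurable_maxr => //; exact: mh.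
exists M => t Tt; rewrite ger0_norm ?le_max ?lexx ?orbT//.
have := hM t Tt; rewrite ler_norml => /andP[_ htM].
by rewrite ge_max htM; apply: le_trans (hM t Tt).
Qed.

Lemma nadmD h k : nadm h -> nadm k -> nadm (fun t => h t + k t).
Proof. by move=> [ah h0] [ak k0]; split; [exact: admD|move=> t; exact: addr_ge0]. Qed.

Lemma nadmZ c h : 0 <= c -> nadm h -> nadm (fun t => c * h t).
Proof. by move=> c0 [ah h0]; split; [exact: admZ|move=> t; exact: mulr_ge0]. Qed.

Lemma Lint_D T h k : 0 < T -> nadm h -> nadm k ->
  Lint T (fun t => h t + k t) = Lint T h + Lint T k.
Proof.
move=> T0 ah ak; apply: EFin_inj; rewrite EFinD -!lamint_fin//; last exact: nadmD.
by rewrite /lamint -iintD//; exact: nadm_iadm.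
Qed.

Lemma Lint_Z T c h : 0 < T -> 0 <= c -> nadm h -> Lint T (fun t => c * h t) = c * Lint T h.
Proof.
move=> T0 c0 ah; apply: EFin_inj; rewrite EFinM -!lamint_fin//; last exact: nadmZ.
by rewrite /lamint -iintZ//; exact: nadm_iadm.
Qed.

(** [lamint] is meant for nonnegative integrands, so a signed function is averaged through its
    positive and negative parts. *)
Definition box_mean T h : R := ((2 * T) ^+ d)^-1 *
  (Lint T (fun t => Num.max (h t) 0) - Lint T (fun t => Num.max (- h t) 0)).

Local Notation mean := box_mean.

(** If [h = a - b] then [h^+ + b = a + h^-], and additivity on nonnegative functions shows that
    every such splitting gives the same mean. Linearity of the mean follows by choosing
    splittings. *)
Lemma mean_split T h a b : 0 < T -> adm h -> nadm a -> nadm b ->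
  (forall t, TT t -> supnorm t <= T -> h t = a t - b t) ->
  mean T h = ((2 * T) ^+ d)^-1 * (Lint T a - Lint T b).
Proof.
move=> T0 ah aa ab hab; congr (_ * _).
have ap := adm_max0 ah; have an := adm_max0 (admN ah).
apply/eqP; rewrite subr_eq addrAC eq_sym subr_eq -!Lint_D//; apply/eqP.
apply: Lint_eq => //; [exact: nadmD|exact: nadmD|].
by move=> t Tt tT; rewrite (hab t Tt tT); case: (leP (a t - b t)); case: (leP (- (a t - b t))); lra.
Qed.

Lemma maxr_split (x : R) : x = Num.max x 0 - Num.max (- x) 0.
Proof. by case: (leP x); case: (leP (- x)); lra. Qed.

Lemma meanD T h k : 0 < T -> adm h -> adm k ->
  mean T (fun t => h t + k t) = mean T h + mean T k.
Proof.
move=> T0 ah ak.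
have ap := adm_max0 ah; have an := adm_max0 (admN ah).
have bp := adm_max0 ak; have bn := adm_max0 (admN ak).
rewrite (mean_split T0 (admD ah ak) (nadmD ap bp) (nadmD an bn)).
  by rewrite !Lint_D// /mean -mulrDr opprD addrACA.
by move=> t _ _; rewrite {1}(maxr_split (h t)) {1}(maxr_split (k t)) opprD addrACA.
Qed.

Lemma meanN T h : 0 < T -> adm h -> mean T (fun t => - h t) = - mean T h.
Proof.
move=> T0 ah; have ap := adm_max0 ah; have an := adm_max0 (admN ah).
rewrite (mean_split T0 (admN ah) an ap) /mean -?mulrN ?opprB//.
by move=> t _ _; rewrite {1}(maxr_split (- h t)) opprK.
Qed.

Lemma meanZ T c h : 0 < T -> adm h -> mean T (fun t => c * h t) = c * mean T h.
Proof.
move=> T0; wlog c0 : c h / 0 <= c => [wl|] ah.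
  have [c0|c0] := leP 0 c; first exact: wl.
  rewrite -[c]opprK mulNr -wl ?oppr_ge0 ?ltW//.
  rewrite -meanN//; last exact: admZ.
  by congr mean; apply/funext => t; rewrite mulNr.
have ap := adm_max0 ah; have an := adm_max0 (admN ah).
rewrite (mean_split T0 (admZ c ah) (nadmZ c0 ap) (nadmZ c0 an)).
  by rewrite !Lint_Z// /mean -mulrBr mulrCA.
by move=> t _ _; rewrite {1}(maxr_split (h t)) mulrBr.
Qed.

Lemma mean_le T h k : 0 < T -> adm h -> adm k ->
  (forall t, TT t -> supnorm t <= T -> h t <= k t) -> mean T h <= mean T k.
Proof.
move=> T0 ah ak hk; apply: ler_wpM2l.
  by rewrite invr_ge0 exprn_ge0// mulr_ge0// ltW.
have ap := adm_max0 ah; have an := adm_max0 (admN ah).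
have bp := adm_max0 ak; have bn := adm_max0 (admN ak).
rewrite lerBlDr addrAC lerBrDr -!Lint_D//; apply: Lint_le => //; [exact: nadmD|exact: nadmD|].
move=> t Tt tT; have := hk t Tt tT.
by rewrite {1}(maxr_split (h t)) {1}(maxr_split (k t)); lra.
Qed.

Lemma mean_eq T h k : 0 < T -> adm h -> adm k ->
  (forall t, TT t -> supnorm t <= T -> h t = k t) -> mean T h = mean T k.
Proof.
move=> T0 ah ak hk; apply/eqP; rewrite eq_le; apply/andP.
by split; apply: mean_le => // t *; rewrite hk.
Qed.

Lemma mean_cst T c : 0 < T -> mean T (fun=> c) = c * (len1 disc T / (2 * T)) ^+ d.
Proof.
move=> T0; rewrite -[in LHS](mulr1 c) meanZ//; last exact: adm_cst.
congr (_ * _).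
rewrite (@mean_split _ _ (fun=> 1) (fun=> 0) T0 (adm_cst 1) (nadm_cst ler01) (nadm_cst (lexx _))); last first.
  by move=> *; rewrite subr0.
by rewrite /Lint !lamint_cst ?ltW//= mul0r subr0 mul1r expr_div_n mulrC.
Qed.

Lemma mean_ge0E T h : 0 < T -> nadm h ->
  lamavg disc T (fun t => (h t)%:E) = (mean T h)%:E.
Proof.
move=> T0 ah; rewrite (mean_split T0 ah.1 ah (nadm_cst (lexx _))); last first.
  by move=> *; rewrite subr0.
by rewrite {2}/Lint lamint_cst ?ltW// mul0r subr0 /lamavg lamint_fin// EFinM.
Qed.

Lemma mean_ge0 T h : 0 < T -> adm h -> (forall t, TT t -> 0 <= h t) -> 0 <= mean T h.
Proof.
move=> T0 ah h0; apply: (@le_trans _ _ (mean T (fun=> 0))).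
  by rewrite mean_cst// mul0r.
by apply: mean_le => //; [exact: adm_cst|move=> t Tt _; exact: h0].
Qed.

Lemma lamavg_eq T (f : 'rV[R]_d -> \bar R) h : 0 < T ->
  (forall t, 0 <= f t)%E -> (~~ disc -> measurable_fun setT (f : Bor -> \bar R)) ->
  nadm h -> (forall t, TT t -> f t = (h t)%:E) ->
  lamavg disc T f = (mean T h)%:E.
Proof.
move=> T0 f0 mf ah fh; rewrite -mean_ge0E// /lamavg; congr (_ * _)%E.
have af : iadm disc (fun g => f (row_of g)).
  by split=> // /mf {}mf; exact: (measurableT_comp mf measurable_row_of).
apply/eqP; rewrite eq_le; apply/andP; split.
  apply: le_iint => //; first exact: nadm_iadm.
  by move=> g bg; have [Tg _] := box_row (ltW T0) bg; rewrite -[X in f X]/(row_of g) fh.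
apply: le_iint => //; first exact: nadm_iadm.
by move=> g bg; have [Tg _] := box_row (ltW T0) bg; rewrite -[X in f X]/(row_of g) fh.
Qed.

End Mean.

Lemma cvg_eq_pinfty (R : realType) (f g : R -> R) (l : R) :
  (forall T, 0 < T -> f T = g T) -> g T @[T --> +oo] --> l -> f T @[T --> +oo] --> l.
Proof.
move=> fg /cvgrPdist_le gl; apply/cvgrPdist_le => e e0; near=> T; rewrite fg//.
by near: T; exact: gl.
Unshelve. all: by end_near. Qed.

(** * Box averages as [T] tends to infinity, and functions null in mean *)

Section Asymptotics.
Variables (R : realType) (disc : bool) (d : nat).
Implicit Types (T c e M : R) (h k : 'rV[R]_d -> R) (t : 'rV[R]_d).
Local Notation TT := (@Tset R disc d).
Local Notation adm := (@adm R disc d).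
Local Notation mean := (@box_mean R disc d).

(** Each floor errs by a number in [[0, 1)], and the two errors enter with opposite signs. *)
Lemma len1_near T : 0 <= T -> `|len1 disc T - 2 * T| <= 1.
Proof.
move=> T0; rewrite /len1; case: disc; last by rewrite subrr normr0.
have fT : Num.floor (- T) <= Num.floor T.
  by apply: le_floor; rewrite (le_trans _ T0)// oppr_le0.
rewrite natr_absz [X in X%:~R]ger0_norm ?subr_ge0// intrB.
have := floor_le T; have := floorD1_gt T.
have := floor_le (- T); have := floorD1_gt (- T).
rewrite !intrD ler_norml; lra.
Qed.

(** The normalisation [(2 T)^d] is not the exact number of lattice points of the box, so for
    [disc = true] the mean of a constant is right only in the limit. *)
Lemma mean_cst_cvg c : mean T (fun=> c) @[T --> +oo] --> c.
Proof.
have ratio : len1 disc T / (2 * T) @[T --> +oo] --> (1 : R).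
  apply/cvgrPdist_le => /= e e0; near=> T.
  have T0 : 0 < T by near: T; exact: nbhs_pinfty_gt.
  have Te : e^-1 <= T by near: T; apply: nbhs_pinfty_ge; rewrite num_real.
  have -> : 1 - len1 disc T / (2 * T) = (2 * T - len1 disc T) / (2 * T).
    by rewrite mulrBl divff// gt_eqF// mulr_gt0.
  rewrite normrM distrC [X in _ * X]gtr0_norm ?invr_gt0 ?mulr_gt0//.
  rewrite ler_pdivrMr ?mulr_gt0//; apply: (le_trans (len1_near (ltW T0))).
  have : 1 <= e * T by rewrite -ler_pdivrMl// mulr1.
  by move=> ?; nra.
have ratioX : (len1 disc T / (2 * T)) ^+ d @[T --> +oo] --> (1 ^+ d : R).
  exact: (continuous_cvg _ (@exprn_continuous R d 1) ratio).
have cvgc : c * (len1 disc T / (2 * T)) ^+ d @[T --> +oo] --> c.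
  have := cvgM (cvg_cst c) ratioX; rewrite expr1n mulr1; exact.
by apply: cvg_eq_pinfty cvgc => T T0; rewrite mean_cst.
Unshelve. all: by end_near. Qed.

(** Cancellation is allowed here; the absolute version is stated as [wnull] of the norm. *)
Definition wnull h : Prop := forall e, 0 < e -> \forall T \near +oo, `|mean T h| <= e.

Lemma wnullP h : wnull h <-> mean T h @[T --> +oo] --> (0 : R).
Proof.
split=> [nh|/cvgrPdist_le nh].
  apply/cvgrPdist_le => e /nh; apply: filterS => T; by rewrite sub0r normrN.
by move=> e /nh; apply: filterS => T; rewrite sub0r normrN.
Qed.

Lemma mean_norm T h : 0 < T -> adm h -> `|mean T h| <= mean T (fun t => `|h t|).
Proof.
move=> T0 ah; rewrite ler_norml -meanN//; last exact: adm_norm.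
apply/andP; split; apply: mean_le => //; try exact: adm_norm.
- exact/admN/adm_norm.
- by move=> t _ _; rewrite lerNl ler_normr lexx orbT.
- by move=> t _ _; exact: ler_norm.
Qed.

Lemma mean_cst_le c : 0 <= c -> \forall T \near +oo, mean T (fun=> c) <= 2 * c.
Proof.
rewrite le_eqVlt => /predU1P[<-|c0].
  near=> T; rewrite mean_cst ?mul0r ?mulr0//; near: T; exact: nbhs_pinfty_gt.
have /cvgrPdist_le /(_ c c0) := @mean_cst_cvg c.
by apply: filterS => T; rewrite distrC ler_norml => /andP[_]; lra.
Unshelve. all: by end_near. Qed.

Lemma wnullD h k : adm h -> adm k -> wnull h -> wnull k -> wnull (fun t => h t + k t).
Proof.
move=> ah ak nh nk e e0; have e2 : 0 < e / 2 by rewrite divr_gt0.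
near=> T; rewrite meanD//.
apply: (le_trans (ler_normD _ _)); rewrite [leRHS](splitr e).
by apply: lerD; near: T; [exact: nh|exact: nk].
Unshelve. all: by end_near. Qed.

Lemma wnullZ c h : adm h -> wnull h -> wnull (fun t => c * h t).
Proof.
move=> ah nh e e0.
have e2 : 0 < e / (`|c| + 1) by rewrite divr_gt0// ltr_wpDl.
near=> T; rewrite meanZ//.
rewrite normrM.
have : `|mean T h| <= e / (`|c| + 1) by near: T; exact: nh.
rewrite ler_pdivlMr ?ltr_wpDl// mulrDr mulr1 mulrC; apply: le_trans.
by rewrite lerDl.
Unshelve. all: by end_near. Qed.

Lemma wnull_le h k : adm h -> adm k -> (forall t, TT t -> `|h t| <= k t) ->
  wnull k -> wnull h.
Proof.
move=> ah ak hk nk e e0; near=> T.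
have T0 : 0 < T by near: T; exact: nbhs_pinfty_gt.
apply: (le_trans (mean_norm T0 ah)).
apply: (@le_trans _ _ `|mean T k|); last by near: T; exact: nk.
apply: (le_trans _ (ler_norm _)); apply: mean_le => //; first exact: adm_norm.
by move=> t Tt _; exact: hk.
Unshelve. all: by end_near. Qed.

Lemma wnull_eq h k : adm h -> adm k -> (forall t, TT t -> h t = k t) ->
  wnull k -> wnull h.
Proof.
move=> ah ak hk nk e e0; near=> T; rewrite (@mean_eq _ _ _ _ _ k)//.
- by near: T; exact: nk.
- by move=> t Tt _; exact: hk.
Unshelve. all: by end_near. Qed.

Lemma wnull_approx h : adm h ->
  (forall e, 0 < e -> exists k, [/\ adm k, wnull k &
     forall t, TT t -> `|h t - k t| <= e]) -> wnull h.
Proof.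
(* [e / 4] because [mean_cst_le] loses a factor [2]; the other half of [e] goes to the mean of
   [k]. *)
move=> ah happ e e0; have e4 : 0 < e / 4 by rewrite divr_gt0.
have [k [ak nk hk]] := happ _ e4.
have ahk : adm (fun t => h t - k t) by apply: admD => //; exact: admN.
have e2 : 0 < e / 2 by rewrite divr_gt0.
near=> T; have T0 : 0 < T by near: T; exact: nbhs_pinfty_gt.
have -> : mean T h = mean T (fun t => (h t - k t) + k t).
  by congr box_mean; apply/funext => t; rewrite subrK.
rewrite meanD//; apply: (le_trans (ler_normD _ _)).
have : `|mean T k| <= e / 2 by near: T; exact: nk.
have : mean T (fun=> e / 4) <= 2 * (e / 4).
  by near: T; apply: mean_cst_le; exact: ltW.
have : `|mean T (fun t => h t - k t)| <= mean T (fun=> e / 4).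
  apply: (le_trans (mean_norm T0 ahk)); apply: mean_le => //.
  - exact: adm_norm.
  - exact: adm_cst.
  - by move=> t Tt _; exact: hk.
lra.
Unshelve. all: by end_near. Qed.

Lemma wnull_norm_approx h : adm h ->
  (forall e, 0 < e -> exists k, [/\ adm k, wnull (fun t => `|k t|) &
     forall t, TT t -> `|h t - k t| <= e]) -> wnull (fun t => `|h t|).
Proof.
move=> ah happ; apply: wnull_approx; first exact: adm_norm.
move=> e /happ[k [ak nk hk]]; exists (fun t => `|k t|); split => //.
  exact: adm_norm.
by move=> t Tt; apply: (le_trans (ler_dist_dist _ _)); exact: hk.
Qed.

(** The truncation [max (|h| - e) 0] is at most [k] on [T^d], hence null, and lies within [e] of
    [|h|]. So domination by a null function up to an arbitrarily small constant is enough. *)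
Lemma wnull_excess h : adm h ->
  (forall e, 0 < e -> exists k, [/\ adm k, wnull k, forall t, 0 <= k t &
     forall t, TT t -> `|h t| <= e + k t]) -> wnull (fun t => `|h t|).
Proof.
move=> ah happ; apply: wnull_approx; first exact: adm_norm.
move=> e e0; have [k [ak nk k0 hk]] := happ _ e0.
pose l t := Num.max (`|h t| - e) 0.
have al : nadm disc l.
  by apply: adm_max0; apply: admD; [exact: adm_norm|exact: adm_cst].
exists l; split; first exact: al.1.
- apply: (wnull_le al.1 ak) => // t Tt; rewrite ger0_norm ?al.2// ge_max k0 andbT.
  by rewrite lerBlDl; exact: hk.
- move=> t Tt; rewrite /l ler_norml.
  by have := normr_ge0 (h t); case: (leP (`|h t| - e)); lra.
Qed.

Lemma adm_indic (A : set 'rV[R]_d) : (~~ disc -> rVborel A) -> adm (\1_A).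
Proof.
move=> mA; split; last by move=> /mA {}mA; apply: measurable_indic.
by exists 1 => t _; rewrite indicE ger0_norm// lern1 leq_b1.
Qed.

Lemma borel_ball M : 0 <= M -> rVborel [set t : 'rV[R]_d | supnorm t <= M].
Proof.
move=> M0; apply: sub_sigma_algebra; exists (fun=> [set` `[- M, M]]).
  by move=> i; exact: measurable_itv.
apply/seteqP; split=> t /= => [tM|tM i].
  by apply: supnorm_le => // i; have := tM i; rewrite in_itv/= ler_norml.
by rewrite in_itv/= -ler_norml (le_trans (supnorm_entry _ _) tM).
Qed.

(** Translation by [a] is injective and [[- m, m]] holds [2 m + 1] integers. *)
Lemma count_int_ball (a : int) (N m : nat) :
  (count (fun j : nat => `|a + j%:Z| <= m%:Z)%R (iota 0 N) <= m.*2.+1)%N.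
Proof.
rewrite -size_filter -(size_map (fun j : nat => a + j%:Z)).
have -> : m.*2.+1 = size [seq (i%:Z - m%:Z)%R | i <- iota 0 m.*2.+1].
  by rewrite size_map size_iota.
apply: uniq_leq_size.
  rewrite map_inj_uniq ?filter_uniq ?iota_uniq// => i j /addrI [] //.
move=> _ /mapP[j +] ->; rewrite mem_filter => /andP[jm _].
apply/mapP; exists (absz (a + j%:Z + m%:Z)%R); last first.
  rewrite gez0_abs; first by rewrite addrK.
  by move: jm; rewrite ler_norml; lia.
rewrite mem_iota /= add0n; move: jm; rewrite ler_norml -addnn; lia.
Qed.

Lemma int1_ball T (m : nat) :
  (int1 disc T (fun x => (\1_([set` `[- m%:R, m%:R]%R] : set R) x)%:E) <= (m.*2.+1%:R)%:E)%E.
Proof.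
rewrite /int1; case: disc; last first.
  rewrite integral_indic//.
  apply: (@le_trans _ _ (lebesgue_measure ([set` `[- m%:R, m%:R]%R] : set R))).
    by apply: le_measure; rewrite ?inE//; exact: measurableI.
  rewrite lebesgue_measure_itv/=; case: ifP => // _; rewrite -EFinB lee_fin.
  by rewrite opprK -natrD ler_nat addnn.
rewrite sumEFin lee_fin.
set a := Num.floor (- T) + 1.
have E j : \1_([set` `[- m%:R, m%:R]%R] : set R) ((a + j%:Z)%:~R) =
    ((`|a + j%:Z| <= m%:Z)%R : nat)%:R :> R.
  rewrite indicE; congr (nat_of_bool _)%:R.
  rewrite mem_setE in_itv/= ler_norml -!(ler_int R) rmorphN/=; done.
under eq_bigr do rewrite E.
rewrite -natr_sum ler_nat; apply: leq_trans (count_int_ball a _ m).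
rewrite -sum1_count [leqRHS]big_mkcond /index_iota subn0.
by apply: leq_sum => j _; case: ifP => // ->.
Qed.


(** A ball lies in a strip that bounds the last coordinate by [m]. Within the box the strip has
    measure of order [T^(d-1)], against the normalisation [(2 T)^d]; a coordinate to bound exists
    because [0 < d]. *)
Lemma ball_wnull M : (0 < d)%N -> 0 <= M ->
  wnull (\1_[set t : 'rV[R]_d | supnorm t <= M]).
Proof.
move=> d0 M0 e e0.
have [m Mm] : exists m : nat, M <= m%:R.
  by exists (Num.truncn M).+1; exact/ltW/truncnS_gt.
have aB : adm (\1_[set t : 'rV[R]_d | supnorm t <= M]).
  by apply: adm_indic => _; exact: borel_ball.
have nB : nadm disc (\1_[set t : 'rV[R]_d | supnorm t <= M]).
  by split=> // t; rewrite indicE.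
have [n dn] : exists n, d = n.+1 by case: (d) d0 => // n _; exists n.
near=> T.
have T0 : 0 < T by near: T; exact: nbhs_pinfty_gt.
(* By [len1_near] the length is at most [2 T + 1]; the doubling absorbs the [1]. *)
have T2 : len1 disc T <= 4 * T.
  have T1 : 1 <= T by near: T; apply: nbhs_pinfty_ge; rewrite num_real.
  by have := len1_near (ltW T0); rewrite ler_norml; lra.
rewrite ger0_norm; last by apply: mean_ge0 => // t _; rewrite indicE.
rewrite -lee_fin -mean_ge0E// /lamavg.
apply: (@le_trans _ _ (((2 * T) ^+ d)^-1%:E * (iint disc T d (fun g =>
    (\1_([set` `[- m%:R, m%:R]%R] : set R) (g n))%:E)))%E).
  apply: lee_wpmul2l; first by rewrite lee_fin invr_ge0 exprn_ge0// mulr_ge0// ltW.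
  apply: le_iint => //.
  - exact: nadm_iadm.
  - split=> [g|_]; first by rewrite lee_fin.
    apply/measurable_EFinP; apply: (measurableT_comp _ (measurable_coord n)).
    exact: measurable_indic.
  - move=> g bg; rewrite lee_fin !indicE ler_nat.
    case: (boolP (_ \in [set t | _])) => //; rewrite inE/= => gM.
    have nd : (n < d)%N by rewrite dn.
    have := supnorm_entry (row_of d g) (Ordinal nd); rewrite mxE/= => gn.
    by rewrite lt0b mem_setE in_itv/= -ler_norml (le_trans gn)// (le_trans gM).
rewrite {1 2}dn (@iint_last _ disc T n
  (fun x => (\1_([set` `[- m%:R, m%:R]%R] : set R) x)%:E) (ltW T0))//; last first.
  by move=> _; apply/measurable_EFinP; exact: measurable_indic.
apply: (@le_trans _ _ (((2 * T) ^+ n.+1)^-1%:E * (((4 * T) ^+ n)%:E * (m.*2.+1%:R)%:E))%E).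
  apply: lee_wpmul2l; first by rewrite lee_fin invr_ge0 exprn_ge0// mulr_ge0// ltW.
  apply: lee_pmul => //.
  - by rewrite lee_fin exprn_ge0// len1_ge0// ltW.
  - by apply: int1_ge0 => x; rewrite lee_fin.
  - by rewrite lee_fin lerXn2r ?nnegrE//; [exact: len1_ge0 (ltW T0)|rewrite mulr_ge0// ltW].
  - exact: int1_ball.
rewrite -!EFinM lee_fin.
have -> : 4 * T = 2 * (2 * T) by lra.
have u0 : 2 * T != 0 by rewrite gt_eqF// mulr_gt0.
have -> : ((2 * T) ^+ n.+1)^-1 * ((2 * (2 * T)) ^+ n * m.*2.+1%:R) =
    (2 * T)^-1 * (2 ^+ n * m.*2.+1%:R).
  move: (2 * T) u0 (m.*2.+1%:R) => u u0 c.
  have un0 : u ^+ n != 0 by rewrite expf_neq0.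
  by rewrite exprMn exprS; move: (u ^+ n) un0 (2 ^+ n) => v v0 w; field; rewrite u0.
rewrite ler_pdivrMl ?mulr_gt0//.
have : 2 ^+ n * m.*2.+1%:R / e <= T by near: T; apply: nbhs_pinfty_ge; rewrite num_real.
rewrite ler_pdivrMr// => h; apply: (le_trans h); nra.
Unshelve. all: by end_near. Qed.

End Asymptotics.

(** * The Koopman-von Neumann lemma *)

Section KoopmanVonNeumann.
Variables (R : realType) (disc : bool) (d : nat).
Implicit Types (T c e M : R) (h k : 'rV[R]_d -> R) (t : 'rV[R]_d).
Local Notation Bor := (g_sigma_algebraType (@rects R d)).
Local Notation TT := (@Tset R disc d).
Local Notation adm := (@adm R disc d).
Local Notation mean := (@box_mean R disc d).
Local Notation wnull := (@wnull R disc d).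

Lemma countable_int_rV : countable [set t : 'rV[R]_d | forall i, isInt (t ord0 i)].
Proof.
apply: (@sub_countable _ _ _ [set: {ffun 'I_d -> int}]); last exact: countableP.
apply: (@card_le_trans _ _ _ ((fun f : {ffun 'I_d -> int} =>
   \row_i ((f i)%:~R : R)) @` setT)); last exact: card_image_le.
apply: subset_card_le => t /= tI.
have [f fE] := choice tI.
by exists [ffun i => f i] => //; apply/rowP => i; rewrite mxE ffunE fE.
Qed.

(** A singleton is a rectangle with singleton sides. *)
Lemma borel_countable (A : set 'rV[R]_d) : countable A -> rVborel A.
Proof.
move=> /countable_injP[f finj]; change (measurable (A : set Bor)).
have -> : A = \bigcup_n (A `&` f @^-1` [set n]).
  by apply/seteqP; split => [t At|t [n _ []]] //; exists (f t).
apply: bigcup_measurable => n _.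
have [->|/set0P[t [At ftn]]] := eqVneq (A `&` f @^-1` [set n]) set0.
  exact: measurable0.
apply: sub_sigma_algebra; exists (fun i => [set t ord0 i]).
  by move=> i; exact: measurable_set1.
apply/seteqP; split => s /= => [st|[As fsn] i].
  by have -> : s = t by apply/rowP => i; exact: st.
by rewrite (finj s t) ?inE// fsn ftn.
Qed.

Lemma borel_Tset : rVborel TT.
Proof.
rewrite /Tset; case: disc; first exact: (borel_countable countable_int_rV).
by change (measurable [set: Bor]).
Qed.

Lemma borel_TsetD (D : set 'rV[R]_d) : rVborel D -> rVborel (TT `\` D).
Proof. by move=> bD; exact: (@measurableD _ Bor _ _ borel_Tset bD). Qed.

Lemma density_oneP (D : set 'rV[R]_d) : rVborel D ->
  density_one disc D <-> wnull (\1_(TT `\` D)).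
Proof.
move=> bD; have nE : nadm disc (\1_(TT `\` D)).
  split; last by move=> t; rewrite indicE.
  by apply: adm_indic => _; exact: borel_TsetD.
rewrite wnullP /density_one /density_zero; split.
  move=> /fine_cvgP[_]; apply: cvg_eq_pinfty => T T0 /=.
  by rewrite mean_ge0E.
move=> nTD; apply: cvg_EFin; first by near=> T; rewrite mean_ge0E.
apply: cvg_eq_pinfty nTD => T T0 /=.
by rewrite mean_ge0E.
Unshelve. all: by end_near. Qed.

(** The bad sets [E n], at accuracy [1 / (n + 1)] for the sum of the first [n + 1] functions,
    increase with [n] and are null. Each [E n] enters the exceptional set only beyond the radius
    [tt n], past which its box averages are at most [1 / (n + 1)]. This keeps the union at density
    zero, and off the union every [F j] is eventually small. *)
Lemma koopman_von_neumann (F : nat -> 'rV[R]_d -> R) :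
  (forall j, adm (F j)) -> (forall j t, 0 <= F j t) -> (forall j, wnull (F j)) ->
  exists D : set 'rV[R]_d, [/\ D `<=` TT, rVborel D, density_one disc D &
    forall j e, 0 < e -> exists M, forall t, D t -> M < supnorm t -> F j t < e].
Proof.
move=> aF F0 nF.
pose S (n : nat) t := \sum_(j < n.+1) F j t.
have aS n : adm (S n) /\ wnull (S n).
  rewrite /S; elim: n => [|n [aS nS]].
    by under eq_fun do rewrite big_ord1.
  under eq_fun do rewrite big_ord_recr/=.
  by split; [exact: admD|exact: wnullD].
have S0 n t : 0 <= S n t by apply: sumr_ge0.
have leS n m t : (n <= m)%N -> S n t <= S m t.
  move=> nm; rewrite /S -(big_mkord xpredT (fun j => F j t)) -(big_mkord xpredT (fun j => F j t)).
  rewrite (big_cat_nat (n := n.+1) (p := m.+1))//= lerDl.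
  exact: sumr_ge0.
pose E n := [set t | n.+1%:R^-1 <= S n t].
have bE n : ~~ disc -> rVborel (E n).
  move=> nd; have [[_ mS] _] := aS n.
  have := mS nd measurableT _ (measurable_itv `[n.+1%:R^-1, +oo[).
  rewrite setTI /E; congr (measurable (_ : set Bor)).
  by apply/seteqP; split => t /=; rewrite in_itv/= andbT.
have aE n : adm (\1_(E n)) by apply: adm_indic; exact: bE.
have nE n : wnull (\1_(E n)).
  (* Chebyshev: [\1_(E n) <= (n + 1) S n]. *)
  apply: (@wnull_le _ _ _ _ (fun t => n.+1%:R * S n t)) => //.
  - by apply: admZ; exact: (aS n).1.
  - move=> t _; rewrite ger0_norm ?indicE//; case: (boolP (t \in E n)).
      by rewrite inE /E/= -ler_pdivrMl// mulr1.
    by move=> _; rewrite mulr_ge0.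
  - by apply: wnullZ; [exact: (aS n).1|exact: (aS n).2].
have /choice[tau tauP] n : exists M, forall T, M < T ->
    `|mean T (\1_(E n))| <= n.+1%:R^-1.
  have [M [_ HM]] := nE n n.+1%:R^-1 ltac:(by []).
  by exists M => T MT; exact: HM.
(* Cumulative sums make [tt] increasing and larger than every [tau n]; the added [1] gives
   [n <= tt n], so [tt] is unbounded. *)
pose tt n := \sum_(j < n.+1) (`|tau j| + 1).
have ttS n : tt n.+1 = tt n + (`|tau n.+1| + 1) by rewrite /tt big_ord_recr.
have tt_ltS n : tt n < tt n.+1 by rewrite ttS ltrDl ltr_wpDl.
have tt_mono : {homo tt : n m / (n <= m)%N >-> n <= m}.
  by apply: homo_leq => // [x y z|n]; [exact: le_trans|exact: ltW].
have tt_ge n : n%:R <= tt n.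
  elim: n => [|n IH]; first by rewrite sumr_ge0// => j _; rewrite addr_ge0.
  by rewrite ttS -natr1 lerD// lerDr.
have tau_tt n : tau n <= tt n.
  rewrite /tt big_ord_recr/= (le_trans (ler_norm _))// addrCA lerDl addr_ge0//.
  by apply: sumr_ge0 => j _; rewrite addr_ge0.
pose EE := \bigcup_n (E n `&` [set t | tt n < supnorm t]).
pose D := TT `\` EE.
have DT : D `<=` TT by move=> t [].
have bD : rVborel D.
  (* For [disc = true] nothing is known about measurability of [E n], but a set of lattice points is
     countable, hence Borel. *)
  case: (boolP disc) => [dt|nd].
    apply: borel_countable; apply: sub_countable countable_int_rV.
    by apply: subset_card_le => t /DT; rewrite /Tset dt.
  apply: (@measurableD _ Bor); first exact: borel_Tset.
  apply: (@bigcup_measurable _ Bor) => n _; apply: (@measurableI _ Bor); first exact: bE.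
  rewrite (_ : [set t | _] = ~` [set t | supnorm t <= tt n]).
    by apply: (@measurableC _ Bor); apply: borel_ball; apply: (le_trans _ (tt_ge n)).
  by apply/seteqP; split => t /=; rewrite ltNge => /negP.
exists D; split => //.
- apply/density_oneP => // e e0.
  have aTD : adm (\1_(TT `\` D)).
    by apply: adm_indic => _; exact: borel_TsetD.
  have [K Ke] : exists K : nat, K.+1%:R^-1 <= e.
    exists (Num.truncn e^-1); rewrite invf_ple ?posrE//.
    exact/ltW/truncnS_gt.
  near=> T.
  have T0 : 0 < T by near: T; exact: nbhs_pinfty_gt.
  have TK : tt K < T by near: T; apply: nbhs_pinfty_gt; rewrite num_real.
  have exn : exists n, (T <= tt n).
    exists (Num.truncn T).+1; apply: (le_trans _ (tt_ge _)).
    exact/ltW/truncnS_gt.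
  (* The least index with [T <= tt _] is a successor, as [tt 0 <= tt K < T]. So
     [tt n < T <= tt n.+1]: in the box of radius [T] only the pieces of [EE] with index at most [n]
     are visible, and they lie in [E n]. *)
  have [[|n] Tn minn] := ex_minnP exn.
    by have := lt_le_trans TK Tn; rewrite ltNge tt_mono.
  have nT : tt n < T.
    rewrite ltNge; apply/negP => /minn; by rewrite ltnn.
  have lt_tt j : tt j < tt n.+1 -> (j <= n)%N.
    by move=> jn; rewrite leqNgt; apply/negP => /tt_mono; rewrite leNgt jn.
  have Kn : (K <= n)%N by apply: lt_tt; exact: lt_le_trans TK Tn.
  rewrite ger0_norm; last by apply: mean_ge0 => // t _; rewrite indicE.
  apply: (@le_trans _ _ (mean T (\1_(E n)))).
    apply: mean_le => // t Tt tT; rewrite !indicE ler_nat.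
    case: (boolP (t \in TT `\` D)) => // /set_mem [_ /not_andP[//|/contrapT]].
    move=> [j _ [Ej tj]]; rewrite lt0b inE /E/=.
    have jn : (j <= n)%N by apply: lt_tt; exact: lt_le_trans tj (le_trans tT Tn).
    apply: le_trans (leS j n t jn); apply: le_trans Ej.
    by rewrite lef_pV2 ?posrE// ler_nat.
  apply: (le_trans (ler_norm _)); apply: (le_trans (tauP n T _)).
    exact: le_lt_trans (tau_tt n) nT.
  by apply: le_trans Ke; rewrite lef_pV2 ?posrE// ler_nat.
- move=> j e e0.
  have [K Ke] : exists K : nat, K.+1%:R^-1 <= e.
    exists (Num.truncn e^-1); rewrite invf_ple ?posrE//.
    exact/ltW/truncnS_gt.
  (* An index at least [j], so that [S] contains the term [F j], and at least [K], so that the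
     threshold is at most [e]. *)
  exists (tt (maxn j K)) => t [Tt nEt] tM.
  have : ~ E (maxn j K) t by move=> Et; apply: nEt; exists (maxn j K).
  rewrite /E/= => /negP; rewrite -ltNge => Sle.
  apply: (@le_lt_trans _ _ (S (maxn j K) t)).
    apply: le_trans (leS j _ t (leq_maxl _ _)).
    by rewrite /S big_ord_recr/= lerDr sumr_ge0.
  apply: (lt_le_trans Sle); apply: le_trans Ke.
  by rewrite lef_pV2 ?posrE// ler_nat ltnS leq_maxr.
Unshelve. all: by end_near. Qed.

End KoopmanVonNeumann.

(** * L1-closures of algebras of bounded functions *)

Section BoundedMeasurable.
Variables (R : realType) (dO : measure_display) (Omega : measurableType dO).
Implicit Types (f g : Omega -> R).

Definition bounded_meas f : Prop :=
  measurable_fun setT f /\ exists M, forall w, `|f w| <= M.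

Local Notation bmeas := bounded_meas.

Lemma bmeas_cst (c : R) : bmeas (fun=> c).
Proof. by split => //; exists `|c|. Qed.

Lemma bmeasD f g : bmeas f -> bmeas g -> bmeas (fun w => f w + g w).
Proof.
move=> [mf [M fM]] [mg [N gN]]; split; first exact: measurable_funD.
by exists (M + N) => w; apply: (le_trans (ler_normD _ _)); exact: lerD.
Qed.

Lemma bmeasM f g : bmeas f -> bmeas g -> bmeas (fun w => f w * g w).
Proof.
move=> [mf [M fM]] [mg [N gN]]; split; first exact: measurable_funM.
by exists (M * N) => w; rewrite normrM; exact: ler_pM.
Qed.

Lemma bmeasZ (c : R) f : bmeas f -> bmeas (fun w => c * f w).
Proof. exact/bmeasM/bmeas_cst. Qed.

Lemma bmeasN f : bmeas f -> bmeas (fun w => - f w).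
Proof.
move=> [mf [M fM]]; split; last by exists M => w; rewrite normrN.
exact: measurable_funN.
Qed.

Lemma bmeasB f g : bmeas f -> bmeas g -> bmeas (fun w => f w - g w).
Proof. by move=> bf bg; apply: bmeasD => //; exact: bmeasN. Qed.

Lemma bmeas_norm f : bmeas f -> bmeas (fun w => `|f w|).
Proof.
move=> [mf [M fM]]; split; last by exists M => w; rewrite normr_id.
exact: measurableT_comp.
Qed.

Lemma bmeas_indic (A : set Omega) : measurable A -> bmeas (\1_A).
Proof.
move=> mA; split; first exact: measurable_indic.
by exists 1 => w; rewrite indicE ger0_norm// lern1 leq_b1.
Qed.

End BoundedMeasurable.

Section Expectation.
Variables (R : realType) (dO : measure_display) (Omega : measurableType dO).
Variable P : probability Omega R.
Implicit Types (f g : Omega -> R).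
Local Notation bmeas := (@bounded_meas R dO Omega).

Definition expec f : R := \int[P]_w f w.

Local Notation Ex := expec.

Lemma bmeas_integrable f : bmeas f -> P.-integrable setT (EFin \o f).
Proof.
move=> [mf [M fM]]; apply: measurable_bounded_integrable => //.
  exact: (le_lt_trans (probability_le1 P measurableT) (ltry 1)).
exists M; split; first exact: num_real.
by move=> N /ltW MN w _; exact: le_trans MN.
Qed.

Lemma ExE f : bmeas f -> (\int[P]_w (f w)%:E = (Ex f)%:E)%E.
Proof. by move=> bf; rewrite /Ex /Rintegral fineK//; exact: integrable_fin_num (bmeas_integrable bf). Qed.

Lemma ExD f g : bmeas f -> bmeas g -> Ex (fun w => f w + g w) = Ex f + Ex g.
Proof. by move=> bf bg; rewrite /Ex RintegralD//; exact: bmeas_integrable. Qed.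

Lemma ExZ (c : R) f : bmeas f -> Ex (fun w => c * f w) = c * Ex f.
Proof. by move=> bf; rewrite /Ex RintegralZl//; exact: bmeas_integrable. Qed.

Lemma Ex_cst (c : R) : Ex (fun=> c) = c.
Proof.
rewrite /Ex Rintegral_cst// [X in fine X](_ : _ = 1%E) ?mulr1//.
exact: probability_setT.
Qed.

Lemma Ex_le f g : bmeas f -> bmeas g -> (forall w, f w <= g w) -> Ex f <= Ex g.
Proof. by move=> bf bg fg; apply: le_Rintegral => //; exact: bmeas_integrable. Qed.

Lemma Ex_ge0 f : (forall w, 0 <= f w) -> 0 <= Ex f.
Proof. by move=> f0; apply: Rintegral_ge0. Qed.

Lemma Ex_norm f : bmeas f -> `|Ex f| <= Ex (fun w => `|f w|).
Proof. by move=> bf; apply: le_normr_Rintegral => //; exact: bmeas_integrable. Qed.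

Lemma Ex_indic (A : set Omega) : measurable A -> Ex (\1_A) = fine (P A).
Proof. by move=> mA; rewrite /Ex /Rintegral integral_indic// setIT. Qed.

Lemma Ex_dist3 f g h : bmeas f -> bmeas g -> bmeas h ->
  Ex (fun w => `|f w - h w|) <= Ex (fun w => `|f w - g w|) + Ex (fun w => `|g w - h w|).
Proof.
move=> bf bg bh.
have bd u v : bmeas u -> bmeas v -> bmeas (fun w => `|u w - v w|).
  by move=> bu bv; apply: bmeas_norm; exact: bmeasB.
rewrite -ExD; try exact: bd.
apply: Ex_le; [exact: bd|by apply: bmeasD; exact: bd|].
by move=> w; exact: ler_distD.
Qed.

Lemma Ex_dominated (f_ : nat -> Omega -> R) f (M : R) :
  (forall n, measurable_fun setT (f_ n)) -> measurable_fun setT f ->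
  (forall n w, `|f_ n w| <= M) -> (forall w, f_ n w @[n --> \oo] --> f w) ->
  bmeas f /\ forall e, 0 < e -> exists n, Ex (fun w => `|f w - f_ n w|) <= e.
Proof.
move=> mf_ mf fM ff.
have fM' w : `|f w| <= M.
  rewrite -(cvg_lim _ (cvg_norm (ff w)))//; apply: limr_le.
    by apply/cvg_ex; exists `|f w|; exact: cvg_norm (ff w).
  by near=> n; exact: fM.
have bf : bmeas f by split => //; exists M.
split=> // e e0.
have [] := @dominated_convergence _ _ R P setT measurableT
  (fun n => EFin \o f_ n) (EFin \o f) (EFin \o fun=> M).
- by move=> n; exact/measurable_EFinP.
- exact/measurable_EFinP.
- by apply: aeW => w _; apply: cvg_EFin; [near=> n|exact: ff].
- exact/bmeas_integrable/bmeas_cst.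
- by apply: aeW => w n _ /=; rewrite lee_fin.
move=> _ + _ => /fine_cvgP[_ /cvgrPdist_le /(_ e e0)[n _ /(_ n (leqnn n))]].
move=> /= ne; exists n; apply: le_trans ne; rewrite sub0r normrN.
apply: le_trans (ler_norm _); rewrite le_eqVlt; apply/orP; left; apply/eqP.
rewrite /Ex /Rintegral; congr fine; apply: eq_integral => w _ /=.
by rewrite distrC.
Unshelve. all: by end_near. Qed.

End Expectation.

Section L1Closure.
Variables (R : realType) (dO : measure_display) (Omega : measurableType dO).
Variable P : probability Omega R.
Implicit Types (f g : Omega -> R).
Local Notation bmeas := (@bounded_meas R dO Omega).
Local Notation Ex := (expec P).

Variable A : set (Omega -> R).
Hypothesis A_bmeas : A `<=` bmeas.
Hypothesis A1 : A (fun=> 1).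
Hypothesis A_compl : forall f, A f -> A (fun w => 1 - f w).
Hypothesis A_mul : forall f g, A f -> A g -> A (fun w => f w * g w).

(** The hypotheses on [A] are the functional form of complement and intersection. They fit the
    trigonometric polynomials as well as the countable class [computable]. *)
Definition L1cl f : Prop :=
  bmeas f /\ forall e, 0 < e -> exists2 g, A g & Ex (fun w => `|f w - g w|) <= e.

Lemma L1cl_sub f : A f -> L1cl f.
Proof.
move=> Af; split; first exact: A_bmeas.
move=> e e0; exists f => //.
by under [X in Ex X]eq_fun do rewrite subrr normr0; rewrite Ex_cst ltW.
Qed.

Lemma L1cl_compl f : L1cl f -> L1cl (fun w => 1 - f w).
Proof.
move=> [bf cf]; split; first by apply: bmeasB => //; exact: bmeas_cst.
move=> e /cf[g Ag fg]; exists (fun w => 1 - g w); first exact: A_compl.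
by under [X in Ex X]eq_fun => w do rewrite opprB addrC addrA subrK distrC.
Qed.

Lemma L1cl_mul f g : L1cl f -> L1cl g -> L1cl (fun w => f w * g w).
Proof.
move=> [bf cf] [bg cg]; split; first exact: bmeasM.
move=> e e0; have e2 : 0 < e / 2 by rewrite divr_gt0.
have [_ [M fM]] := bf.
have M1 : 0 < `|M| + 1 by rewrite ltr_wpDl.
(* [g'] comes first: its bound [N] decides how close [f'] has to be to [f]. *)
have [g' Ag' gg'] := cg (e / 2 / (`|M| + 1)) ltac:(by rewrite divr_gt0).
have bg' := A_bmeas Ag'; have [_ [N gN]] := bg'.
have N1 : 0 < `|N| + 1 by rewrite ltr_wpDl.
have [f' Af' ff'] := cf (e / 2 / (`|N| + 1)) ltac:(by rewrite divr_gt0).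
have bf' := A_bmeas Af'.
exists (fun w => f' w * g' w); first exact: A_mul.
have bd u v : bmeas u -> bmeas v -> bmeas (fun w => `|u w - v w|).
  by move=> bu bv; apply: bmeas_norm; exact: bmeasB.
apply: (@le_trans _ _ (Ex (fun w => (`|M| + 1) * `|g w - g' w| + (`|N| + 1) * `|f w - f' w|))).
  apply: Ex_le; first by apply: bd; exact: bmeasM.
    by apply: bmeasD; apply: bmeasZ; exact: bd.
  move=> w; have -> : f w * g w - f' w * g' w = f w * (g w - g' w) + g' w * (f w - f' w).
    by ring.
  apply: (le_trans (ler_normD _ _)); rewrite !normrM; apply: lerD; apply: ler_wpM2r => //.
    by apply: (le_trans (fM w)); apply: (le_trans (ler_norm _)); rewrite lerDl.
  by apply: (le_trans (gN w)); apply: (le_trans (ler_norm _)); rewrite lerDl.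
rewrite ExD ?ExZ; try by [exact: bd|apply: bmeasZ; exact: bd].
rewrite [leRHS](splitr e); apply: lerD; rewrite mulrC -ler_pdivlMr//.
Qed.

Lemma L1cl_lim (f_ : nat -> Omega -> R) f (M : R) :
  (forall n, L1cl (f_ n)) -> (forall n w, `|f_ n w| <= M) ->
  (forall w, f_ n w @[n --> \oo] --> f w) -> L1cl f.
Proof.
move=> cf fM ff.
have mf : measurable_fun setT f.
  by apply: (@measurable_fun_cvg _ _ _ setT f_) => // n; exact: (cf n).1.1.
have [bf Hf] := Ex_dominated P (fun n => (cf n).1.1) mf fM ff.
split=> // e e0; have e2 : 0 < e / 2 by rewrite divr_gt0.
have [n ne] := Hf _ e2; have [g Ag ge] := (cf n).2 _ e2.
exists g => //; apply: (le_trans (Ex_dist3 P bf (cf n).1 (A_bmeas Ag))).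
by rewrite [leRHS](splitr e) lerD.
Qed.

(** The sets with indicator in the closure form a sigma-algebra: finite unions have indicator
    [1 - \prod (1 - \1_(F k))], and these converge boundedly to the indicator of the countable
    union. *)
Lemma L1cl_sigma_algebra (G : set (set Omega)) :
  (forall B, G B -> L1cl (\1_B)) -> forall B, <<s G >> B -> L1cl (\1_B).
Proof.
move=> HG; have c0 : L1cl (fun=> 0).
  by have := L1cl_compl (L1cl_sub A1); under eq_fun do rewrite subrr.
suff S : <<s G >> `<=` [set B | L1cl (\1_B)] by exact: S.
apply: smallest_sub => //; split.
- by rewrite /= indic0.
- move=> B /= /L1cl_compl; rewrite setTD; congr L1cl.
  by apply/funext => w; rewrite !indicE in_setC; case: (_ \in _); rewrite ?subrr ?subr0.
- move=> F /= cF.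
  pose f_ (n : nat) (w : Omega) : R := 1 - \prod_(k < n) (1 - \1_(F k) w).
  have fE n w : f_ n w = \1_(\big[setU/set0]_(k < n) F k) w.
    rewrite /f_; elim: n => [|n IH]; first by rewrite !big_ord0 subrr indic0.
    have : \prod_(k < n) (1 - \1_(F k) w) = 1 - \1_(\big[setU/set0]_(k < n) F k) w :> R.
      by rewrite -IH; ring.
    rewrite !big_ord_recr/= => ->; rewrite !indicE in_setU.
    by do 2 case: (_ \in _) => /=; ring.
  apply: (@L1cl_lim f_ _ 1).
  + move=> n; apply: L1cl_compl; elim: n => [|n IH].
      by under eq_fun do rewrite big_ord0; exact: L1cl_sub.
    under eq_fun do rewrite big_ord_recr/=.
    by apply: L1cl_mul => //; exact: L1cl_compl.
  + by move=> n w; rewrite fE indicE ger0_norm// lern1 leq_b1.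
  + move=> w; have [[k _ Fkw]|nF] := pselect ((\bigcup_k F k) w).
      apply: cvg_near_cst; exists k.+1 => // n /= kn.
      rewrite fE !indicE !mem_set//; first by exists k.
      by rewrite -bigcup_mkord; exists k.
    apply: cvg_near_cst; exists 0%N => // n _.
    rewrite fE !indicE !memNset//; rewrite -bigcup_mkord => -[k _ Fkw].
    by apply: nF; exists k.
Qed.

End L1Closure.

(** * Correlations along the action *)

Section Field.
Variables (R : realType) (disc : bool) (d : nat).
Variables (dO : measure_display) (Omega : measurableType dO).
Variables (P : probability Omega R) (X0 : Omega -> R).
Variable theta : 'rV[R]_d -> Omega -> Omega.
Hypothesis act : mp_action disc P theta.
Hypothesis mX0 : measurable_fun setT X0.
Hypothesis mfield : ~~ disc -> measurable_field X0 theta.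
Implicit Types (f g : Omega -> R) (t s : 'rV[R]_d).

Local Notation TT := (@Tset R disc d).
Local Notation adm := (@adm R disc d).
Local Notation mean := (@box_mean R disc d).
Local Notation wnull := (@wnull R disc d).
Local Notation Bor := (g_sigma_algebraType (@rects R d)).
Local Notation Ex := (expec P).
Local Notation bmeas := (@bounded_meas R dO Omega).

Definition gensX : set (set Omega) :=
  [set (X0 \o theta t) @^-1` B | t in TT & B in [set B : set R | measurable B]].
Local Notation OX := (g_sigma_algebraType gensX).
Local Notation SX := (sigmaX disc X0 theta).

Definition sbm f : Prop := @bounded_meas R _ OX f.

Lemma Tset0 : TT 0.
Proof. by rewrite /Tset; case: disc => //= i; rewrite mxE; exists 0. Qed.

Lemma TsetN t : TT t -> TT (- t).
Proof.
rewrite /Tset; case: disc => //= ti i; rewrite mxE.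
by have [k ->] := ti i; exists (- k); rewrite mulrNz.
Qed.

Lemma TsetD s t : TT s -> TT t -> TT (s + t).
Proof.
rewrite /Tset; case: disc => //= si ti i; rewrite mxE.
by have [k ->] := si i; have [l ->] := ti i; exists (k + l); rewrite intrD.
Qed.

Lemma thetaD s t w : TT s -> TT t -> theta s (theta t w) = theta (s + t) w.
Proof. by move=> Ts Tt; have [_ aD _ _] := act; rewrite aD. Qed.

(** The action is invertible, which turns the images in the definitions of ergodicity and weak
    mixing into preimages. *)
Lemma theta_image t (B : set Omega) : TT t -> theta t @` B = theta (- t) @^-1` B.
Proof.
have [a0 _ _ _] := act.
move=> Tt; apply/seteqP; split => [_ [w Bw <-]|w Bw] /=.
  by rewrite thetaD//; [rewrite addNr a0|exact: TsetN].
exists (theta (- t) w) => //; rewrite thetaD//; last exact: TsetN.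
by rewrite subrr a0.
Qed.

Lemma measurable_theta t : TT t -> measurable_fun setT (theta t).
Proof. by have [_ _ mt _] := act; exact: mt. Qed.

Lemma SX_measurable A : SX A -> measurable A.
Proof.
suff S : SX `<=` measurable by exact: S.
apply: smallest_sub; first exact: sigma_algebra_measurable.
move=> _ [t Tt [B mB <-]]; rewrite -[X in measurable X]setTI.
by apply: measurableT_comp => //; exact: measurable_theta.
Qed.

Lemma SX_theta t A : TT t -> SX A -> SX (theta t @^-1` A).
Proof.
move=> Tt; suff : measurable_fun setT (theta t : OX -> OX).
  by move=> mt SA; rewrite -[X in SX X]setTI; exact: mt.
apply: (@measurability _ _ OX OX _ _ gensX) => //.
move=> _ [_ [s Ts [B mB <-]] <-]; rewrite setTI; apply: sub_sigma_algebra.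
exists (s + t); first exact: TsetD.
by exists B => //; apply/seteqP; split => w /=; rewrite thetaD.
Qed.

Lemma sbm_bmeas f : sbm f -> bmeas f.
Proof.
by move=> [mf bf]; split=> // _ B mB; apply: SX_measurable; exact: (mf measurableT _ mB).
Qed.

Lemma sbm_theta t f : TT t -> sbm f -> sbm (fun w => f (theta t w)).
Proof.
move=> Tt [mf [M fM]]; split; last by exists M.
move=> _ B mB; rewrite setTI; apply: (SX_theta Tt (A := f @^-1` B)).
by have := mf measurableT _ mB; rewrite setTI.
Qed.

Lemma sbm_indic A : SX A -> sbm (\1_A).
Proof. by move=> SA; apply: (@bmeas_indic R _ OX). Qed.

Lemma Ex_theta t f : TT t -> bmeas f -> Ex (fun w => f (theta t w)) = Ex f.
Proof.
move=> Tt bf; have [_ _ _ inv] := act; have mt := measurable_theta Tt.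
rewrite /expec /Rintegral; congr fine.
have := @integral_pushforward _ _ _ _ R _ mt P setT (EFin \o f).
rewrite preimage_setT => <- //.
- apply: eq_measure_integral => A mA _; exact: inv.
- exact/measurable_EFinP/bf.1.
- apply: bmeas_integrable; split; first exact: (measurableT_comp bf.1 mt).
  by have [_ [M fM]] := bf; exists M => w; exact: fM.
Qed.

(** For a generator the condition reads [X0 (theta (s - t) w)] in [B], which is joint measurability
    composed with the map sending [(t, w)] to [(s - t, w)]. The sets [A] with the property form a
    sigma-algebra. *)
Lemma measurable_joint_set A : ~~ disc -> SX A ->
  measurable [set p : Bor * Omega | A (theta (- p.1) p.2)].
Proof.
move=> nd; have TTT t : TT t by rewrite /Tset (negbTE nd).
suff S : SX `<=` [set A | measurable [set p : Bor * Omega | A (theta (- p.1) p.2)]].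
  exact: S.
apply: smallest_sub.
  split => /=.
  - by rewrite (_ : [set _ | _] = set0)//; apply/seteqP; split.
  - move=> B mB; rewrite (_ : [set _ | _] =
      ~` [set p : Bor * Omega | B (theta (- p.1) p.2)]); first exact: measurableC.
    by apply/seteqP; split => p /=; [case|].
  - move=> F mF; rewrite (_ : [set _ | _] =
      \bigcup_k [set p : Bor * Omega | F k (theta (- p.1) p.2)]).
      exact: bigcup_measurable.
    by apply/seteqP; split => p.
move=> _ [s _ [B mB <-]] /=.
pose phi (p : Bor * Omega) : Bor * Omega := (s - p.1, p.2).
have mphi : measurable_fun setT phi.
  apply: measurable_fun_pair => //.
  apply: measurable_fun_entry => i.
  have mE := measurableT_comp (@measurable_entry R d i) (@measurable_fst _ _ Bor Omega).
  apply: (@eq_measurable_fun _ _ _ _ _ (fun p : Bor * Omega => s ord0 i - p.1 ord0 i)).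
    by move=> p _; rewrite /phi !mxE.
  by apply: measurable_funB => //; exact: mE.
have mX : measurable [set p : Bor * Omega | B (X0 (theta p.1 p.2))].
  by rewrite measurable_prod_measurableType; exact: mfield nd B mB.
have := mphi measurableT _ mX; rewrite setTI; congr measurable.
by apply/seteqP; split => p /=; rewrite thetaD.
Qed.

Lemma measurable_joint f : ~~ disc -> sbm f ->
  measurable_fun setT (fun p : Bor * Omega => f (theta (- p.1) p.2)).
Proof.
move=> nd [mf _] _ B mB; rewrite setTI.
apply: (measurable_joint_set nd (A := f @^-1` B)).
by have := mf measurableT _ mB; rewrite setTI.
Qed.

(** The sign in [theta (- t)] matches the image [theta_t B], whose indicator is
    [\1_B o theta_(-t)]. *)
Definition covar f g t : R := Ex (fun w => f w * g (theta (- t) w)) - Ex f * Ex g.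

Local Notation corr := covar.

Lemma bmeas_prod f g t : sbm f -> sbm g -> TT t ->
  bmeas (fun w => f w * g (theta (- t) w)).
Proof.
move=> sf sg Tt; apply: bmeasM; first exact: sbm_bmeas.
by apply/sbm_bmeas/sbm_theta => //; exact: TsetN.
Qed.

Lemma adm_prod f g : sbm f -> sbm g ->
  adm (fun t => Ex (fun w => f w * g (theta (- t) w))).
Proof.
move=> sf sg; have [_ [M fM]] := sf; have [_ [N gN]] := sg.
have fgMN t w : `|f w * g (theta (- t) w)| <= M * N by rewrite normrM; exact: ler_pM.
split.
  exists (M * N) => t Tt; have bp := bmeas_prod sf sg Tt.
  apply: (le_trans (Ex_norm P bp)); rewrite -[leRHS](Ex_cst P).
  by apply: Ex_le => //; [exact: bmeas_norm|exact: bmeas_cst].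
move=> nd; have TTT t : TT t by rewrite /Tset (negbTE nd).
(* Adding the bound [M * N] makes the integrand nonnegative, as Tonelli requires; it is subtracted
   again at the end. *)
pose F (p : Bor * Omega) : \bar R := (f p.2 * g (theta (- p.1) p.2) + M * N)%:E.
have mF : measurable_fun setT F.
  apply/measurable_EFinP; apply: measurable_funD => //; apply: measurable_funM.
    exact: (measurableT_comp (sbm_bmeas sf).1 measurable_snd).
  exact: measurable_joint.
have F0 p : (0 <= F p)%E.
  rewrite lee_fin; have := fgMN p.1 p.2; rewrite ler_norml => /andP[MN _].
  by rewrite -[leLHS](addNr (M * N)) lerD2r.
have mint := measurable_fun_fubini_tonelli_F (m2 := P) F mF F0.
apply: (@eq_measurable_fun _ _ _ _ _ (fun t : Bor => fine (fubini_F P F t) - M * N)).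
  move=> t _; have bp := bmeas_prod sf sg (TTT t).
  rewrite /fubini_F -[fine _]/(Ex (fun w => f w * g (theta (- t) w) + M * N)).
  by rewrite ExD ?Ex_cst ?addrK//; exact: bmeas_cst.
by apply: measurable_funB => //; exact: measurableT_comp.
Qed.

Lemma adm_corr f g : sbm f -> sbm g -> adm (corr f g).
Proof. by move=> sf sg; apply: admD; [exact: adm_prod|exact: adm_cst]. Qed.

Lemma corr_linl (a b : R) f f' g t : sbm f -> sbm f' -> sbm g -> TT t ->
  corr (fun w => a * f w + b * f' w) g t = a * corr f g t + b * corr f' g t.
Proof.
move=> sf sf' sg Tt; rewrite /corr.
have bf := bmeas_prod sf sg Tt; have bf' := bmeas_prod sf' sg Tt.
rewrite (_ : (fun w => _ * g _) = fun w => a * (f w * g (theta (- t) w)) +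
    b * (f' w * g (theta (- t) w))); last by apply/funext => w; ring.
rewrite !ExD ?ExZ//; try by [exact: bmeasZ|exact: sbm_bmeas|apply: bmeasZ; exact: sbm_bmeas].
by ring.
Qed.

Lemma corr_linr (a b : R) f g g' t : sbm f -> sbm g -> sbm g' -> TT t ->
  corr f (fun w => a * g w + b * g' w) t = a * corr f g t + b * corr f g' t.
Proof.
move=> sf sg sg' Tt; rewrite /corr.
have bf := bmeas_prod sf sg Tt; have bf' := bmeas_prod sf sg' Tt.
rewrite (_ : (fun w => f w * _) = fun w => a * (f w * g (theta (- t) w)) +
    b * (f w * g' (theta (- t) w))); last by apply/funext => w; ring.
rewrite !ExD ?ExZ//; try by [exact: bmeasZ|exact: sbm_bmeas|apply: bmeasZ; exact: sbm_bmeas].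
by ring.
Qed.

Lemma sbmB f g : sbm f -> sbm g -> sbm (fun w => f w - g w).
Proof. exact: bmeasB. Qed.

(** L1 continuity in [f], uniform in [t]; each of the two terms of the correlation contributes
    [N * c]. The uniformity lets nullity pass to L1 limits. *)
Lemma corr_bound f g (N c : R) t : sbm f -> sbm g -> TT t -> 0 <= N ->
  (forall w, `|g w| <= N) -> Ex (fun w => `|f w|) <= c -> `|corr f g t| <= 2 * N * c.
Proof.
move=> sf sg Tt N0 gN fc.
have bf := sbm_bmeas sf; have bg := sbm_bmeas sg; have bp := bmeas_prod sf sg Tt.
have bnf := bmeas_norm bf.
have c0 : 0 <= c by apply: le_trans fc; exact: Ex_ge0.
have fNc : Ex (fun w => N * `|f w|) <= N * c by rewrite ExZ// ler_wpM2l.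
have -> : 2 * N * c = N * c + N * c by ring.
apply: (le_trans (ler_normB _ _)); apply: lerD.
  apply: (le_trans (Ex_norm P bp)); apply: le_trans fNc.
  apply: Ex_le; [exact: bmeas_norm|exact: bmeasZ|].
  by move=> w; rewrite normrM mulrC ler_wpM2r.
rewrite normrM mulrC; apply: ler_pM => //.
  rewrite -[leRHS](Ex_cst P); apply: (le_trans (Ex_norm P bg)).
  by apply: Ex_le => //; [exact: bmeas_norm|exact: bmeas_cst].
exact: (le_trans (Ex_norm P bf)).
Qed.

(** Invariance of [P] exchanges the two functions at the cost of replacing [t] by [- t]. *)
Lemma corr_boundr f g (N c : R) t : sbm f -> sbm g -> TT t -> 0 <= N ->
  (forall w, `|f w| <= N) -> Ex (fun w => `|g w|) <= c -> `|corr f g t| <= 2 * N * c.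
Proof.
move=> sf sg Tt N0 fN gc.
have -> : corr f g t = corr g f (- t); last first.
  by apply: corr_bound => //; exact: TsetN.
rewrite /corr opprK [Ex f * _]mulrC; congr (_ - _).
have sft := sbm_theta Tt sf.
have [a0 _ _ _] := act.
have bp : bmeas (fun w => g w * f (theta t w)).
  by apply: bmeasM; [exact: sbm_bmeas|exact: sbm_bmeas].
rewrite -(Ex_theta (TsetN Tt) bp); congr expec; apply/funext => w.
by rewrite thetaD ?subrr ?a0 1?mulrC//; exact: TsetN.
Qed.

Lemma P_image A B t : SX A -> SX B -> TT t ->
  P (A `&` theta t @` B) = (Ex (fun w => \1_A w * \1_B (theta (- t) w)))%:E.
Proof.
move=> SA SB Tt; rewrite theta_image//.
have SBt := SX_theta (TsetN Tt) SB.
have mAB : measurable (A `&` theta (- t) @^-1` B).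
  by apply: measurableI; exact: SX_measurable.
rewrite (_ : (fun w => _) = \1_(A `&` theta (- t) @^-1` B)).
  by rewrite Ex_indic// fineK// fin_num_measure.
by apply/funext => w; rewrite indicI.
Qed.

Lemma ergodicP : ergodic disc P X0 theta <->
  forall A B, SX A -> SX B -> wnull (corr (\1_A) (\1_B)).
Proof.
suff main A B : SX A -> SX B ->
   (lamavg disc T (fun t => P (A `&` (theta t @` B))) @[T --> +oo] --> (P A * P B)%E)
   <-> wnull (corr (\1_A) (\1_B)).
  by split => H A B SA SB; apply/main => //; exact: H.
move=> SA SB; have sA := sbm_indic SA; have sB := sbm_indic SB.
have mA := SX_measurable SA; have mB := SX_measurable SB.
pose h t := Ex (fun w => \1_A w * \1_B (theta (- t) w)).
have nh : nadm disc h.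
  by split; [exact: adm_prod|move=> t; apply: Ex_ge0 => w; rewrite mulr_ge0].
have lE T : 0 < T -> lamavg disc T (fun t => P (A `&` (theta t @` B))) = (mean T h)%:E.
  move=> T0; apply: lamavg_eq => //; last by move=> t Tt; exact: P_image.
  move=> nd; have TTT t : TT t by rewrite /Tset (negbTE nd).
  rewrite (_ : (fun t => _) = EFin \o h); first by apply/measurable_EFinP; exact: (nh.1.2 nd).
  by apply/funext => t; rewrite P_image.
have PAB : (P A * P B = (Ex (\1_A) * Ex (\1_B))%:E)%E.
  by rewrite EFinM !Ex_indic// !fineK// fin_num_measure.
set c := Ex (\1_A) * Ex (\1_B) in PAB *; rewrite PAB.
have mc T : 0 < T -> mean T (corr (\1_A) (\1_B)) = mean T h - mean T (fun=> c).
  by move=> T0; rewrite -meanN ?meanD//; [exact: nh.1|exact/admN/adm_cst|exact: adm_cst].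
rewrite wnullP; split.
  move=> /fine_cvgP[_ hc].
  have hB : (fine (lamavg disc T (fun t => P (A `&` (theta t @` B)))) - mean T (fun=> c))
      @[T --> +oo] --> c - c by apply: cvgB => //; exact: mean_cst_cvg.
  by rewrite subrr in hB; apply: cvg_eq_pinfty hB => T T0; rewrite mc// lE.
move=> cc; apply: cvg_EFin; first by near=> T; rewrite lE.
have cD : (mean T (corr (\1_A) (\1_B)) + mean T (fun=> c)) @[T --> +oo] --> 0 + c.
  by apply: cvgD => //; exact: mean_cst_cvg.
by rewrite add0r in cD; apply: cvg_eq_pinfty cD => T T0 /=; rewrite mc// lE// subrK.
Unshelve. all: by end_near. Qed.

(** Simple functions are reached by linearity, and a bounded nonnegative function is a dominated
    limit of simple ones, hence an L1 limit. *)
Lemma sbm_ind (C : set (Omega -> R)) :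
  (forall A, SX A -> C (\1_A)) ->
  (forall a b f g, sbm f -> sbm g -> C f -> C g -> C (fun w => a * f w + b * g w)) ->
  (forall f, sbm f ->
     (forall e, 0 < e -> exists g, [/\ sbm g, C g & Ex (fun w => `|f w - g w|) <= e]) ->
     C f) ->
  forall f, sbm f -> C f.
Proof.
move=> Cind Clin Cap f sf; have [mf [M fM]] := sf.
have SXT : SX setT by exact: (@measurableT _ OX).
have C1 : C (fun=> 1) by have := Cind _ SXT; rewrite indicT.
have s1 : sbm (fun=> 1) by exact: bmeas_cst.
(* [approx] needs a nonnegative function; the constant is removed again by linearity. *)
pose f' w := f w + M.
have f'0 w : 0 <= f' w.
  by have := fM w; rewrite ler_norml => /andP[+ _]; rewrite /f'; lra.
have sf' : sbm f' by apply: bmeasD => //; exact: bmeas_cst.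
suff Cf' : C f'.
  have := Clin 1 (- M) _ _ sf' s1 Cf' C1.
  by congr C; apply/funext => w; rewrite /f'; ring.
have mf' : measurable_fun setT (EFin \o f' : OX -> \bar R).
  by apply/measurable_EFinP; exact: sf'.1.
(* Taken over [OX], so that the level sets of the simple functions belong to [sigma_X]. *)
pose f_ := @approx _ OX R setT (EFin \o f').
have scm (a : R) A : SX A -> sbm (fun w => a * \1_A w) /\ C (fun w => a * \1_A w).
  move=> SA; split; first by apply: bmeasZ; exact: sbm_indic.
  have := Clin a 0 _ _ (sbm_indic SA) (sbm_indic SA) (Cind _ SA) (Cind _ SA).
  by congr C; apply/funext => w; rewrite mul0r addr0.
have sD u v : sbm u -> sbm v -> C u -> C v -> C (fun w => u w + v w).
  move=> su sv Cu Cv; have := Clin 1 1 _ _ su sv Cu Cv.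
  by congr C; apply/funext => w; rewrite !mul1r.
have mA n k : SX (@dyadic_approx _ OX R setT (EFin \o f') n k).
  rewrite /dyadic_approx; case: ifPn => [kn|_]; last exact: (@measurable0 _ OX).
  rewrite -preimage_comp.
  by apply: (mf' measurableT); apply/measurable_image_EFin; exact: measurable_itv.
have mB n : SX (@integer_approx _ OX R setT (EFin \o f') n).
  exact: (@emeasurable_fun_c_infty _ OX R).
have Cf_ n : sbm (f_ n) /\ C (f_ n).
  suff [sS CS] : sbm (fun x => \sum_(k < n * 2 ^ n) k%:R * 2 ^- n *
      \1_(@dyadic_approx _ OX R setT (EFin \o f') n k) x) /\
      C (fun x => \sum_(k < n * 2 ^ n) k%:R * 2 ^- n *
      \1_(@dyadic_approx _ OX R setT (EFin \o f') n k) x).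
    have [sB CB] := scm n%:R _ (mB n).
    by split; [exact: bmeasD|exact: sD].
  elim: (n * 2 ^ n)%N => [|m [sS CS]].
    have [s0 C0] := scm 0 _ SXT.
    have E0 : (fun w : Omega => (0 : R) * \1_[set: Omega] w) = (fun=> 0).
      by apply/funext => w; rewrite mul0r.
    rewrite E0 in s0 C0.
    by split; [move: s0|move: C0]; under [in X in _ -> X]eq_fun do rewrite big_ord0.
  under eq_fun do rewrite big_ord_recr/=.
  have [s1' C1'] := scm (m%:R * 2 ^- n) _ (mA n m).
  by split; [exact: bmeasD|exact: sD].
apply: Cap => // e e0.
have f_le n w : `|f_ n w| <= M + M.
  have : ((f_ n w)%:E <= (f' w)%:E)%E.
    exact: (@le_approx _ OX R setT (EFin \o f') n w (fun w _ => f'0 w) I).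
  rewrite lee_fin => fnf.
  rewrite ger0_norm; last first.
    rewrite /f_ /approx addr_ge0 ?mulr_ge0//; apply: sumr_ge0 => k _.
    by rewrite !mulr_ge0.
  apply: (le_trans fnf); rewrite lerD2r; apply: (le_trans (ler_norm _)); exact: fM.
have f_cvg w : f_ n w @[n --> \oo] --> f' w.
  apply: (@cvg_approx _ OX R setT (EFin \o f') w) => //; last exact: ltry.
  by move=> v _; rewrite lee_fin.
have [_ /(_ e e0)[n ne]] := Ex_dominated P (fun n => (sbm_bmeas (Cf_ n).1).1)
  (sbm_bmeas sf').1 f_le f_cvg.
by exists (f_ n); split => //; have [] := Cf_ n.
Qed.

End Field.

(** * Mixing of trigonometric polynomials *)

Section StrongMixing.
Variables (R : realType) (alpha : R) (disc : bool) (d : nat).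
Variables (dO : measure_display) (Omega : measurableType dO).
Variables (P : probability Omega R) (X0 : Omega -> R).
Variable theta : 'rV[R]_d -> Omega -> Omega.
Hypothesis alpha0 : 0 < alpha.
Hypothesis act : mp_action disc P theta.
Hypothesis sas : SaS_field alpha disc P X0 theta.
Hypothesis mfield : ~~ disc -> measurable_field X0 theta.
Implicit Types (f g : Omega -> R) (t s : 'rV[R]_d).

Local Notation TT := (@Tset R disc d).
Local Notation adm := (@adm R disc d).
Local Notation wnull := (@wnull R disc d).
Local Notation Ex := (expec P).
Local Notation OX := (g_sigma_algebraType (gensX disc X0 theta)).
Local Notation SX := (sigmaX disc X0 theta).
Local Notation sbm := (sbm disc X0 theta).
Local Notation corr := (covar P theta).

Let mX0 : measurable_fun setT X0 := sas.1.
Let acorr f g (sf : sbm f) (sg : sbm g) : adm (corr f g) :=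
  adm_corr act mX0 mfield sf sg.

Lemma corr_subl f f' g t : sbm f -> sbm f' -> sbm g -> TT t ->
  corr f g t - corr f' g t = corr (fun w => f w - f' w) g t.
Proof.
move=> sf sf' sg Tt; have := corr_linl act mX0 1 (-1) sf sf' sg Tt.
rewrite mul1r mulN1r => <-; congr covar.
by apply/funext => w; rewrite mul1r mulN1r.
Qed.

Lemma corr_subr f g g' t : sbm f -> sbm g -> sbm g' -> TT t ->
  corr f g t - corr f g' t = corr f (fun w => g w - g' w) t.
Proof.
move=> sf sg sg' Tt; have := corr_linr act mX0 1 (-1) sf sg sg' Tt.
rewrite mul1r mulN1r => <-; congr covar.
by apply/funext => w; rewrite mul1r mulN1r.
Qed.

Lemma sbm_lin (a b : R) f g : sbm f -> sbm g -> sbm (fun w => a * f w + b * g w).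
Proof. by move=> sf sg; apply: bmeasD; exact: bmeasZ. Qed.

Lemma corr_wnull_approxl f g : sbm f -> sbm g ->
  (forall e, 0 < e -> exists f', [/\ sbm f', wnull (corr f' g) &
     Ex (fun w => `|f w - f' w|) <= e]) -> wnull (corr f g).
Proof.
move=> sf sg app; have [_ [N gN]] := sg.
have gN' w : `|g w| <= `|N| + 1 by apply: (le_trans (gN w)); rewrite (le_trans (ler_norm N))// lerDl.
have N1 : 0 < `|N| + 1 by rewrite ltr_wpDl.
apply: wnull_approx; first exact: acorr.
move=> e e0; have e' : 0 < e / (2 * (`|N| + 1)) by rewrite divr_gt0// mulr_gt0.
have [f' [sf' nf' ff']] := app _ e'.
exists (corr f' g); split => //; first exact: acorr.
move=> t Tt; rewrite corr_subl//.
apply: (le_trans (corr_bound act mX0 (sbmB sf sf') sg Tt (ltW N1) gN' ff')).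
by rewrite mulrC divfK// gt_eqF// mulr_gt0.
Qed.

Lemma corr_wnull_approxr f g : sbm f -> sbm g ->
  (forall e, 0 < e -> exists g', [/\ sbm g', wnull (corr f g') &
     Ex (fun w => `|g w - g' w|) <= e]) -> wnull (corr f g).
Proof.
move=> sf sg app; have [_ [N fN]] := sf.
have fN' w : `|f w| <= `|N| + 1 by apply: (le_trans (fN w)); rewrite (le_trans (ler_norm N))// lerDl.
have N1 : 0 < `|N| + 1 by rewrite ltr_wpDl.
apply: wnull_approx; first exact: acorr.
move=> e e0; have e' : 0 < e / (2 * (`|N| + 1)) by rewrite divr_gt0// mulr_gt0.
have [g' [sg' ng' gg']] := app _ e'.
exists (corr f g'); split => //; first exact: acorr.
move=> t Tt; rewrite corr_subr//.
apply: (le_trans (corr_boundr act mX0 sf (sbmB sg sg') Tt (ltW N1) fN' gg')).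
by rewrite mulrC divfK// gt_eqF// mulr_gt0.
Qed.

Lemma wnull_lin (a b : R) (h k : 'rV[R]_d -> R) : adm h -> adm k ->
  wnull h -> wnull k -> wnull (fun t => a * h t + b * k t).
Proof.
by move=> ah ak nh nk; apply: wnullD; [exact: admZ|exact: admZ|exact: wnullZ|exact: wnullZ].
Qed.

(** Linearity and L1 continuity extend the hypothesis from indicators to functions, one argument at
    a time. *)
Lemma ergodic_corr : ergodic disc P X0 theta ->
  forall f g, sbm f -> sbm g -> wnull (corr f g).
Proof.
move=> /(ergodicP act mX0 mfield) erg.
have ergA A g : SX A -> sbm g -> wnull (corr (\1_A) g).
  move=> SA; have sA := sbm_indic SA.
  move: g; apply: (sbm_ind act mX0); first by move=> B SB; exact: erg.
    move=> a b f g sf sg nf ng.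
    apply: (@wnull_eq _ _ _ _ (fun t => a * corr (\1_A) f t + b * corr (\1_A) g t)).
    - by apply: acorr => //; exact: sbm_lin.
    - by apply: admD; apply: admZ; exact: acorr.
    - by move=> t Tt; exact: (corr_linr act mX0).
    - by apply: wnull_lin => //; exact: acorr.
  by move=> f sf app; exact: corr_wnull_approxr.
move=> f g + sg; move: f; apply: (sbm_ind act mX0); first by move=> B SB; exact: ergA.
  move=> a b f f' sf sf' nf nf'.
  apply: (@wnull_eq _ _ _ _ (fun t => a * corr f g t + b * corr f' g t)).
  - by apply: acorr => //; exact: sbm_lin.
  - by apply: admD; apply: admZ; exact: acorr.
  - by move=> t Tt; exact: (corr_linl act mX0).
  - by apply: wnull_lin => //; exact: acorr.
by move=> f sf app; exact: corr_wnull_approxl.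
Qed.

(** * Linear combinations of the field and the stability identity *)

Definition Lin (Y : Omega -> R) : Prop :=
  exists n (a : 'I_n -> R) (t : 'I_n -> 'rV[R]_d), (forall j, TT (t j)) /\
    Y = fun w => \sum_(j < n) a j * X0 (theta (t j) w).

Lemma Lin0 : Lin (fun=> 0).
Proof.
exists 0%N, (fun=> 0), (fun=> 0); split; first by case.
by apply/funext => w; rewrite big_ord0.
Qed.

Lemma LinX t : TT t -> Lin (fun w => X0 (theta t w)).
Proof.
move=> Tt; exists 1%N, (fun=> 1), (fun=> t); split => //.
by apply/funext => w; rewrite big_ord1 mul1r.
Qed.

Lemma LinZ (c : R) Y : Lin Y -> Lin (fun w => c * Y w).
Proof.
move=> [n [a [t [Tt ->]]]]; exists n, (fun j => c * a j), t; split => //.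
by apply/funext => w; rewrite mulr_sumr; apply: eq_bigr => j _; rewrite mulrA.
Qed.

Lemma LinD Y Z : Lin Y -> Lin Z -> Lin (fun w => Y w + Z w).
Proof.
move=> [n [a [t [Tt ->]]]] [m [b [s [Ts ->]]]].
exists (n + m)%N, (fun j => match fintype.split j with inl i => a i | inr i => b i end),
  (fun j => match fintype.split j with inl i => t i | inr i => s i end); split.
  by move=> j; case: (fintype.split j).
apply/funext => w; rewrite big_split_ord/=; congr (_ + _); apply: eq_bigr => i _.
  by rewrite (unsplitK (inl i)).
by rewrite (unsplitK (inr i)).
Qed.

Lemma LinN Y : Lin Y -> Lin (fun w => - Y w).
Proof.
move=> /(LinZ (-1)); congr Lin.
by apply/funext => w; rewrite mulN1r.
Qed.

Lemma LinB Y Z : Lin Y -> Lin Z -> Lin (fun w => Y w - Z w).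
Proof. by move=> LY LZ; apply: LinD => //; exact: LinN. Qed.

Lemma Lin_theta t Y : TT t -> Lin Y -> Lin (fun w => Y (theta t w)).
Proof.
move=> Tt [n [a [s [Ts ->]]]]; exists n, a, (fun j => s j + t); split.
  by move=> j; exact: TsetD.
by apply/funext => w; apply: eq_bigr => j _; rewrite (thetaD act).
Qed.

Lemma Lin_measurable Y : Lin Y -> measurable_fun setT (Y : OX -> R).
Proof.
move=> [n [a [t [Tt ->]]]]; apply: measurable_sum => j.
apply: measurable_funM => // _ B mB; rewrite setTI; apply: sub_sigma_algebra.
by exists (t j) => //; exists B.
Qed.

Lemma sbm_cos Y : Lin Y -> sbm (fun w => cos (Y w)).
Proof.
move=> LY; split; last by exists 1 => w; rewrite ler_norml cos_geN1 cos_le1.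
apply: (measurableT_comp _ (Lin_measurable LY)).
exact: (continuous_measurable_fun (@continuous_cos R)).
Qed.

Lemma sbm_sin Y : Lin Y -> sbm (fun w => sin (Y w)).
Proof.
move=> LY; split; last by exists 1 => w; rewrite ler_norml sin_geN1 sin_le1.
apply: (measurableT_comp _ (Lin_measurable LY)).
exact: (continuous_measurable_fun (@continuous_sin R)).
Qed.

Lemma Ex_sin Y : Lin Y -> Ex (fun w => sin (Y w)) = 0.
Proof.
move=> LY; have [n [a [t [Tt YE]]]] := LY.
have [sigma _ /(_ 1)[_]] := sas.2 n a t Tt.
rewrite YE in LY *; under eq_integral do rewrite mul1r.
rewrite (ExE P (sbm_bmeas act mX0 (sbm_sin LY))) => h.
exact: EFin_inj h.
Qed.

(** Chosen so that [kappa^alpha = 2]: scaling by it doubles the exponent of the characteristic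
    function, that is, squares its value. *)
Definition kappa : R := 2 `^ alpha^-1.

Lemma Ex_cos_kappa Y : Lin Y ->
  Ex (fun w => cos (kappa * Y w)) = Ex (fun w => cos (Y w)) ^+ 2.
Proof.
move=> LY; have [n [a [t [Tt YE]]]] := LY.
have [sigma _ H] := sas.2 n a t Tt.
have [+ _] := H kappa; have [+ _] := H 1.
rewrite YE in LY *; under eq_integral do rewrite mul1r.
rewrite (ExE P (sbm_bmeas act mX0 (sbm_cos LY))).
rewrite (ExE P (sbm_bmeas act mX0 (sbm_cos (LinZ kappa LY)))).
move=> h1 h2; rewrite (EFin_inj h1) (EFin_inj h2).
rewrite normr1 powR1 mulr1 (ger0_norm (powR_ge0 _ _)) -powRrM.
rewrite mulVf ?gt_eqF// powRr1// expr2 -expRD; congr expR.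
by ring.
Qed.

(** This is [Z_t - c], split by the addition formula into two correlations to which ergodicity
    applies. [Y2] comes first because [covar] moves its second argument; the product of the sine
    means is zero. *)
Definition zdiff Y1 Y2 t : R :=
  corr (fun w => cos (Y2 w)) (fun w => cos (Y1 w)) t +
  corr (fun w => sin (Y2 w)) (fun w => sin (Y1 w)) t.

Lemma adm_zdiff Y1 Y2 : Lin Y1 -> Lin Y2 -> adm (zdiff Y1 Y2).
Proof.
by move=> L1 L2; apply: admD; apply: acorr; first [exact: sbm_cos|exact: sbm_sin].
Qed.

Lemma zdiffE Y1 Y2 t : Lin Y1 -> Lin Y2 -> TT t ->
  zdiff Y1 Y2 t = Ex (fun w => cos (Y1 (theta (- t) w) - Y2 w)) -
    Ex (fun w => cos (Y1 w)) * Ex (fun w => cos (Y2 w)).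
Proof.
move=> L1 L2 Tt; rewrite /zdiff /covar (Ex_sin L1) mulr0 subr0.
rewrite addrAC [X in _ - X]mulrC; congr (_ - _).
rewrite -ExD.
- by congr expec; apply/funext => w; rewrite cosB [cos (Y2 w) * _]mulrC [sin (Y2 w) * _]mulrC.
- exact: (bmeas_prod act mX0 (sbm_cos L2) (sbm_cos L1) Tt).
- exact: (bmeas_prod act mX0 (sbm_sin L2) (sbm_sin L1) Tt).
Qed.

Hypothesis erg : ergodic disc P X0 theta.

Lemma wnull_zdiff Y1 Y2 : Lin Y1 -> Lin Y2 -> wnull (zdiff Y1 Y2).
Proof.
move=> L1 L2; have [sc1 sc2] := (sbm_cos L1, sbm_cos L2).
have [ss1 ss2] := (sbm_sin L1, sbm_sin L2).
by apply: wnullD; [exact: acorr|exact: acorr|exact: ergodic_corr|exact: ergodic_corr].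
Qed.

(* If Z_t averages to c and Z_t^2 averages to c^2, then (Z_t - c)^2 averages to 0. *)
Lemma wnull_norm_zdiff Y1 Y2 : Lin Y1 -> Lin Y2 -> wnull (fun t => `|zdiff Y1 Y2 t|).
Proof.
move=> L1 L2; have az := adm_zdiff L1 L2.
have [K1 K2] := (LinZ kappa L1, LinZ kappa L2).
pose c := Ex (fun w => cos (Y1 w)) * Ex (fun w => cos (Y2 w)).
(* On [T^d] this is [(Z_t^2 - c^2) - 2 c (Z_t - c) = (Z_t - c)^2]. The factor [1] gives it the shape
   expected by [wnull_lin]. *)
pose q t := 1 * zdiff (fun w => kappa * Y1 w) (fun w => kappa * Y2 w) t +
  (- (2 * c)) * zdiff Y1 Y2 t.
have aq : adm q by apply: admD; apply: admZ => //; exact: adm_zdiff.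
have nq : wnull q by apply: wnull_lin => //; [exact: adm_zdiff|exact: wnull_zdiff|exact: wnull_zdiff].
have qE t : TT t -> q t = zdiff Y1 Y2 t ^+ 2.
  move=> Tt; have L12 := LinB (Lin_theta (TsetN Tt) L1) L2.
  rewrite /q !zdiffE// !Ex_cos_kappa//.
  under [X in expec P X]eq_fun do rewrite -mulrBr.
  by rewrite Ex_cos_kappa// -/c /c; ring.
(* [|z| <= e + z^2 / e] for every real [z], so a null square forces a null absolute value. *)
apply: wnull_excess => // e e0; exists (fun t => `|e^-1 * q t|).
split=> //; first by apply: adm_norm; exact: admZ.
- apply: (@wnull_eq _ _ _ _ (fun t => e^-1 * q t)); [by apply: adm_norm; exact: admZ|exact: admZ| |exact: wnullZ].
  by move=> t Tt; rewrite qE// ger0_norm// mulr_ge0// ?sqr_ge0// invr_ge0 ltW.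
- move=> t Tt; rewrite qE// [X in _ + X]ger0_norm; last by rewrite mulr_ge0// ?sqr_ge0// invr_ge0 ltW.
  rewrite -[zdiff _ _ _ ^+ 2]real_normK ?num_real// -lerBlDl ler_pdivlMl//.
  by have := normr_ge0 (zdiff Y1 Y2 t); nra.
Qed.

Definition strong f g : Prop := wnull (fun t => `|corr f g t|).

Lemma wnull_norm_lin (a b : R) (h k l : 'rV[R]_d -> R) : adm h -> adm k -> adm l ->
  (forall t, TT t -> l t = a * h t + b * k t) ->
  wnull (fun t => `|h t|) -> wnull (fun t => `|k t|) -> wnull (fun t => `|l t|).
Proof.
move=> ah ak al lE nh nk.
have ah' := adm_norm ah; have ak' := adm_norm ak.
apply: (@wnull_le _ _ _ _ (fun t => `|a| * `|h t| + `|b| * `|k t|)); last exact: wnull_lin.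
- exact: adm_norm.
- by apply: admD; exact: admZ.
- by move=> t Tt; rewrite normr_id lE// (le_trans (ler_normD _ _))// !normrM.
Qed.

Lemma strong_linl (a b : R) f f' g : sbm f -> sbm f' -> sbm g ->
  strong f g -> strong f' g -> strong (fun w => a * f w + b * f' w) g.
Proof.
move=> sf sf' sg; apply: (@wnull_norm_lin a b); [exact: acorr|exact: acorr| |].
  by apply: acorr => //; exact: sbm_lin.
by move=> t Tt; exact: (corr_linl act mX0).
Qed.

Lemma strong_linr (a b : R) f g g' : sbm f -> sbm g -> sbm g' ->
  strong f g -> strong f g' -> strong f (fun w => a * g w + b * g' w).
Proof.
move=> sf sg sg'; apply: (@wnull_norm_lin a b); [exact: acorr|exact: acorr| |].
  by apply: acorr => //; exact: sbm_lin.
by move=> t Tt; exact: (corr_linr act mX0).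
Qed.

(** A sign change of [Y2] flips the sine term only; the half sum and half difference with
    [zdiff Y1 Y2] therefore isolate the two correlations. *)
Lemma zdiffN Y1 Y2 t : Lin Y1 -> Lin Y2 -> TT t ->
  zdiff Y1 (fun w => - Y2 w) t =
  corr (fun w => cos (Y2 w)) (fun w => cos (Y1 w)) t -
  corr (fun w => sin (Y2 w)) (fun w => sin (Y1 w)) t.
Proof.
move=> L1 L2 Tt; rewrite /zdiff; congr (_ + _).
  by congr covar; apply/funext => w; rewrite cosN.
have := corr_linl act mX0 (-1) 0 (sbm_sin L2) (sbm_sin L2) (sbm_sin L1) Tt.
rewrite mulN1r mul0r addr0 => <-; congr covar.
by apply/funext => w; rewrite sinN mulN1r mul0r addr0.
Qed.

Lemma strong_coscos Y1 Y2 : Lin Y1 -> Lin Y2 ->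
  strong (fun w => cos (Y2 w)) (fun w => cos (Y1 w)).
Proof.
move=> L1 L2; have L2' := LinN L2.
apply: (wnull_norm_lin (a := 2^-1) (b := 2^-1) _ _ _ _
  (wnull_norm_zdiff L1 L2) (wnull_norm_zdiff L1 L2')).
- exact: adm_zdiff.
- exact: adm_zdiff.
- by apply: acorr; exact: sbm_cos.
- by move=> t Tt; rewrite zdiffN// /zdiff; lra.
Qed.

Lemma strong_sinsin Y1 Y2 : Lin Y1 -> Lin Y2 ->
  strong (fun w => sin (Y2 w)) (fun w => sin (Y1 w)).
Proof.
move=> L1 L2; have L2' := LinN L2.
apply: (wnull_norm_lin (a := 2^-1) (b := - 2^-1) _ _ _ _
  (wnull_norm_zdiff L1 L2) (wnull_norm_zdiff L1 L2')).
- exact: adm_zdiff.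
- exact: adm_zdiff.
- by apply: acorr; exact: sbm_sin.
- by move=> t Tt; rewrite zdiffN// /zdiff; lra.
Qed.

(** By the product formula this is half the mean of two sines of linear combinations, both zero by
    symmetry. Hence the mixed correlations vanish identically. *)
Lemma Ex_sincos Y1 Y2 : Lin Y1 -> Lin Y2 ->
  Ex (fun w => sin (Y1 w) * cos (Y2 w)) = 0.
Proof.
move=> L1 L2.
have E1 := Ex_sin (LinD L1 L2); have E2 := Ex_sin (LinB L1 L2).
have b1 := sbm_bmeas act mX0 (sbm_sin (LinD L1 L2)).
have b2 := sbm_bmeas act mX0 (sbm_sin (LinB L1 L2)).
have -> : (fun w => sin (Y1 w) * cos (Y2 w)) =
    fun w => 2^-1 * (sin (Y1 w + Y2 w) + sin (Y1 w - Y2 w)).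
  by apply/funext => w; rewrite sinB sinD; lra.
by rewrite ExZ ?ExD// ?E1 ?E2 ?addr0 ?mulr0//; exact: bmeasD.
Qed.

Lemma wnull_zero (h : 'rV[R]_d -> R) : adm h -> (forall t, TT t -> h t = 0) -> wnull h.
Proof.
move=> ah h0; apply: (wnull_eq ah (adm_cst _ _ _) h0) => e e0; near=> T.
by rewrite mean_cst// mul0r normr0 ltW.
Unshelve. all: by end_near. Qed.

Lemma strong_sincos Y1 Y2 : Lin Y1 -> Lin Y2 ->
  strong (fun w => sin (Y2 w)) (fun w => cos (Y1 w)).
Proof.
move=> L1 L2; apply: wnull_zero.
  by apply/adm_norm/acorr; [exact: sbm_sin|exact: sbm_cos].
move=> t Tt; rewrite /covar (Ex_sin L2) mul0r subr0.
by rewrite (Ex_sincos L2 (Lin_theta (TsetN Tt) L1)) normr0.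
Qed.

Lemma strong_cossin Y1 Y2 : Lin Y1 -> Lin Y2 ->
  strong (fun w => cos (Y2 w)) (fun w => sin (Y1 w)).
Proof.
move=> L1 L2; apply: wnull_zero.
  by apply/adm_norm/acorr; [exact: sbm_cos|exact: sbm_sin].
move=> t Tt; rewrite /covar (Ex_sin L1) mulr0 subr0.
under [X in expec P X]eq_fun do rewrite mulrC.
by rewrite (Ex_sincos (Lin_theta (TsetN Tt) L1) L2) normr0.
Qed.

(** Linear combinations are the only constructor besides sines and cosines, so bilinear statements
    follow by induction on both arguments; products are recovered in [trig_mul] from the
    product-to-sum formulas. *)
Inductive trigpoly : (Omega -> R) -> Prop :=
| trig_cos Y : Lin Y -> trigpoly (fun w => cos (Y w))
| trig_sin Y : Lin Y -> trigpoly (fun w => sin (Y w))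
| trig_lin (a b : R) f g : trigpoly f -> trigpoly g -> trigpoly (fun w => a * f w + b * g w).

Local Notation trig := trigpoly.

Lemma trig_sbm f : trig f -> sbm f.
Proof.
by elim => [Y|Y|a b u v _ su _ sv]; [exact: sbm_cos|exact: sbm_sin|exact: sbm_lin].
Qed.

Lemma strong_trig f g : trig f -> trig g -> strong f g.
Proof.
move=> + tg; elim => [Y LY|Y LY|a b u v tu IHu tv IHv].
- elim: tg => [Z LZ|Z LZ|a b u v tu IHu tv IHv].
  + exact: strong_coscos.
  + exact: strong_cossin.
  + by apply: strong_linr => //; [exact: sbm_cos|exact: trig_sbm|exact: trig_sbm].
- elim: tg => [Z LZ|Z LZ|a b u v tu IHu tv IHv].
  + exact: strong_sincos.
  + exact: strong_sinsin.
  + by apply: strong_linr => //; [exact: sbm_sin|exact: trig_sbm|exact: trig_sbm].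
- by apply: strong_linl => //; exact: trig_sbm.
Qed.

Lemma strong_approx f g : sbm f -> sbm g ->
  (forall e, 0 < e -> exists2 f', trig f' & Ex (fun w => `|f w - f' w|) <= e) ->
  (forall e, 0 < e -> exists2 g', trig g' & Ex (fun w => `|g w - g' w|) <= e) ->
  strong f g.
Proof.
move=> sf sg appf appg; have [_ [N gN]] := sg.
have gN' w : `|g w| <= `|N| + 1 by apply: (le_trans (gN w)); rewrite (le_trans (ler_norm N))// lerDl.
have N1 : 0 < `|N| + 1 by rewrite ltr_wpDl.
apply: wnull_norm_approx; first exact: acorr.
move=> e e0; have e' : 0 < e / 2 / (2 * (`|N| + 1)) by rewrite !divr_gt0// mulr_gt0.
have [f' tf' ff'] := appf _ e'; have sf' := trig_sbm tf'.
(* [f'] is fixed first: its bound [M] sets the accuracy required of [g']. *)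
have [_ [M fM]] := sf'.
have fM' w : `|f' w| <= `|M| + 1 by apply: (le_trans (fM w)); rewrite (le_trans (ler_norm M))// lerDl.
have M1 : 0 < `|M| + 1 by rewrite ltr_wpDl.
have e'' : 0 < e / 2 / (2 * (`|M| + 1)) by rewrite !divr_gt0// mulr_gt0.
have [g' tg' gg'] := appg _ e''; have sg' := trig_sbm tg'.
exists (corr f' g'); split; [exact: acorr|exact: strong_trig|].
move=> t Tt; rewrite -(subrKA (corr f' g t)).
apply: (le_trans (ler_normD _ _)); rewrite [leRHS](splitr e); apply: lerD.
  rewrite corr_subl//.
  apply: (le_trans (corr_bound act mX0 (sbmB sf sf') sg Tt (ltW N1) gN' ff')).
  by rewrite mulrC divfK// gt_eqF// mulr_gt0.
rewrite corr_subr//.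
apply: (le_trans (corr_boundr act mX0 sf' (sbmB sg sg') Tt (ltW M1) fM' gg')).
by rewrite mulrC divfK// gt_eqF// mulr_gt0.
Qed.

End StrongMixing.

(** * Trigonometric approximation of indicators *)

Section StepPolynomials.
Variable R : realType.
Implicit Types (x z r s : R) (n m : nat).

Lemma bernoulli_ge x m : 0 <= x -> 1 + m%:R * x <= (1 + x) ^+ m.
Proof.
move=> x0; elim: m => [|m IH]; first by rewrite mul0r addr0 expr0.
rewrite exprS -natr1.
have : (1 + x) * (1 + m%:R * x) <= (1 + x) * (1 + x) ^+ m.
  by rewrite ler_wpM2l// addr_ge0.
apply: le_trans; have := ler0n R m; nra.
Qed.

Lemma bernoulli_le x m : 0 <= x <= 1 -> 1 - m%:R * x <= (1 - x) ^+ m.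
Proof.
move=> /andP[x0 x1]; elim: m => [|m IH]; first by rewrite mul0r subr0 expr0.
rewrite exprS -natr1.
have : (1 - x) * (1 - m%:R * x) <= (1 - x) * (1 - x) ^+ m.
  by rewrite ler_wpM2l// subr_ge0.
apply: le_trans; have := ler0n R m; nra.
Qed.

(** With [s = sqrt r], one factor [s^n] absorbs [n + 1]: Bernoulli gives
    [(1 - s) (n + 1) <= (2 - s)^n], and [(2 - s) s <= 1]. *)
Lemma cvg_nat_exprn r : 0 <= r < 1 -> n.+1%:R * r ^+ n @[n --> \oo] --> (0 : R).
Proof.
move=> /andP[r0 r1]; pose s := Num.sqrt r.
have s0 : 0 <= s by exact: sqrtr_ge0.
have s1 : s < 1 by rewrite -sqrtr1 ltr_sqrt.
have y0 : 0 < 1 - s by rewrite subr_gt0.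
have bound n : n.+1%:R * r ^+ n <= (1 - s)^-1 * s ^+ n.
  have -> : r ^+ n = s ^+ n * s ^+ n by rewrite -exprMn -expr2 sqr_sqrtr.
  rewrite mulrA ler_wpM2r ?exprn_ge0// -[leRHS]mulr1 ler_pdivlMl//.
  have : (1 + (1 - s)) ^+ n * s ^+ n <= 1.
    by rewrite -exprMn exprn_ile1//; [rewrite mulr_ge0//; lra|nra].
  apply: le_trans; rewrite mulrA ler_wpM2r ?exprn_ge0//.
  apply: le_trans (bernoulli_ge n (ltW y0)).
  by rewrite -natr1; have := ler0n R n; nra.
apply: (@squeeze_cvgr _ _ _ _ (fun=> 0) (geometric (1 - s)^-1 s)).
- by near=> n; rewrite mulr_ge0 ?exprn_ge0//=; exact: bound.
- exact: cvg_cst.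
- by apply: cvg_geometric; rewrite ger0_norm.
Unshelve. all: by end_near. Qed.

(** A polynomial step at [1/2], of the kind used in elementary proofs of the Stone-Weierstrass
    theorem. The exponent times [z^n] is [(n + 1) (2 z)^n], which tends to [0] below [1/2] and is at
    least [n + 1] from [1/2] on; the factor [n + 1] settles the point [1/2] itself. *)
Definition step_poly n z : R := (1 - z ^+ n) ^+ (n.+1 * 2 ^ n).

Lemma step_poly_itv n z : 0 <= z <= 1 -> 0 <= step_poly n z <= 1.
Proof.
move=> /andP[z0 z1]; have z01 : 0 <= 1 - z ^+ n <= 1.
  by rewrite subr_ge0 exprn_ile1//= lerBlDr lerDl exprn_ge0.
by case/andP: z01 => a b; rewrite exprn_ge0//= exprn_ile1.
Qed.

Lemma cvg_step_poly z : 0 <= z <= 1 ->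
  step_poly n z @[n --> \oo] --> ((z < 2^-1)%R%:R : R).
Proof.
move=> z01; have /andP[z0 z1] := z01.
have zn n : 0 <= z ^+ n <= 1 by rewrite exprn_ge0// exprn_ile1.
have mz n : (n.+1 * 2 ^ n)%:R * z ^+ n = n.+1%:R * (2 * z) ^+ n.
  by rewrite natrM natrX exprMn mulrA.
case: ltP => z2 /=.
  apply: (@squeeze_cvgr _ _ _ _ (fun n => 1 - n.+1%:R * (2 * z) ^+ n) (fun=> 1)).
  - near=> n; have /andP[_ ->] := step_poly_itv n z01; rewrite andbT.
    by rewrite -mz; exact: bernoulli_le.
  - rewrite -[X in _ --> X](subr0 1); apply: cvgB; first exact: cvg_cst.
    by apply: cvg_nat_exprn; apply/andP; split; lra.
  - exact: cvg_cst.
apply: (@squeeze_cvgr _ _ _ _ (fun=> 0) harmonic); last 2 first.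
- exact: cvg_cst.
- exact: cvg_harmonic.
near=> n; have /andP[-> _] := step_poly_itv n z01.
rewrite /= /harmonic -[leRHS]mul1r ler_pdivlMr//.
(* [(1 - x)^m (1 + x)^m <= 1] and Bernoulli give [(1 - x)^m <= 1 / (1 + m x)], here with
   [m x >= n + 1]. *)
have : step_poly n z * (1 + z ^+ n) ^+ (n.+1 * 2 ^ n) <= 1.
  have /andP[z0n z1n] := zn n.
  by rewrite /step_poly -exprMn exprn_ile1//; nra.
apply: le_trans; apply: ler_wpM2l; first by have /andP[] := step_poly_itv n z01.
apply: le_trans (bernoulli_ge _ _); last by have /andP[] := zn n.
rewrite mz; apply: (@le_trans _ _ (n.+1%:R * 1)); first by rewrite mulr1.
apply: (@le_trans _ _ (n.+1%:R * (2 * z) ^+ n)); last by rewrite lerDr.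
by rewrite ler_wpM2l// exprn_ege1//; lra.
Unshelve. all: by end_near. Qed.

End StepPolynomials.

Section TrigClosure.
Variables (R : realType) (disc : bool) (d : nat).
Variables (dO : measure_display) (Omega : measurableType dO).
Variables (P : probability Omega R) (X0 : Omega -> R).
Variable theta : 'rV[R]_d -> Omega -> Omega.
Hypothesis act : mp_action disc P theta.
Hypothesis mX0 : measurable_fun setT X0.
Implicit Types (f g : Omega -> R) (t s : 'rV[R]_d).

Local Notation TT := (@Tset R disc d).
Local Notation SX := (sigmaX disc X0 theta).
Local Notation trig := (trigpoly disc X0 theta).
Local Notation Lin := (Lin disc X0 theta).
Local Notation L1t := (L1cl P trig).

(** Rational thresholds leave time as the only possibly uncountable parameter; countable generation
    can then be proved for one [q] at a time. *)
Definition raysX : set (set Omega) :=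
  [set (X0 \o theta t) @^-1` `]ratr q, +oo[ | t in TT & q in [set: rat]].

Lemma SX_rays : SX `<=` <<s raysX >>.
Proof.
apply: smallest_sub; first exact: smallest_sigma_algebra.
move=> _ [t Tt [B mB <-]].
pose T' := g_sigma_algebraType raysX.
suff mf : measurable_fun setT (X0 \o theta t : T' -> R).
  by have := mf measurableT _ mB; rewrite setTI.
apply: (measurability _ (RGenOInfty.measurableE R)) => _ [_ [x ->] <-]; rewrite setTI.
have -> : (X0 \o theta t) @^-1` `]x, +oo[ =
    \bigcup_(q in [set: rat]) (if x < ratr q then (X0 \o theta t) @^-1` `]ratr q, +oo[ else set0).
  apply/seteqP; split => [w /=|w [q _]].
    rewrite in_itv/= andbT => xX; have [q] := rat_in_itvoo xX.
    rewrite in_itv/= => /andP[xq qX]; exists q => //.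
    by rewrite xq /= in_itv/= qX.
  by case: ifP => // xq; rewrite /= !in_itv/= !andbT; exact: lt_trans.
apply: (@countable_bigcupT_measurable _ T'); first exact: countableP.
move=> q; case: ifP => // _.
by apply: sub_sigma_algebra; exists t => //; exists q.
Qed.

Lemma trig_bmeas : trig `<=` @bounded_meas R dO Omega.
Proof. by move=> f tf; exact: (sbm_bmeas act mX0 (trig_sbm tf)). Qed.

Lemma trig1 : trig (fun=> 1).
Proof. by have := trig_cos (Lin0 disc X0 theta); rewrite cos0. Qed.

Lemma trig_compl f : trig f -> trig (fun w => 1 - f w).
Proof.
move=> /(trig_lin 1 (-1) trig1); congr trigpoly.
by apply/funext => w; rewrite mulr1 mulN1r.
Qed.

Lemma trig_eqlin (a b : R) f g h : trig f -> trig g ->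
  (forall w, h w = a * f w + b * g w) -> trig h.
Proof. by move=> tf tg hE; have := trig_lin a b tf tg; congr trigpoly; apply/funext => w. Qed.

Lemma trig_mul f g : trig f -> trig g -> trig (fun w => f w * g w).
Proof.
move=> + tg; elim => [Y LY|Y LY|a b u v tu IHu tv IHv]; last first.
  by apply: (trig_eqlin IHu IHv (a := a) (b := b)) => w; ring.
- elim: tg => [Z LZ|Z LZ|a b u v tu IHu tv IHv]; last first.
  + by apply: (trig_eqlin IHu IHv (a := a) (b := b)) => w; ring.
  + apply: (trig_eqlin (trig_cos (LinB LY LZ)) (trig_cos (LinD LY LZ))
      (a := 2^-1) (b := - 2^-1)) => w.
    by rewrite cosB cosD; lra.
  + apply: (trig_eqlin (trig_sin (LinB LY LZ)) (trig_sin (LinD LY LZ))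
      (a := 2^-1) (b := 2^-1)) => w.
    by rewrite sinB sinD; lra.
- elim: tg => [Z LZ|Z LZ|a b u v tu IHu tv IHv]; last first.
  + by apply: (trig_eqlin IHu IHv (a := a) (b := b)) => w; ring.
  + apply: (trig_eqlin (trig_sin (LinB LY LZ)) (trig_sin (LinD LY LZ))
      (a := - 2^-1) (b := 2^-1)) => w.
    by rewrite sinB sinD; lra.
  + apply: (trig_eqlin (trig_cos (LinB LY LZ)) (trig_cos (LinD LY LZ))
      (a := 2^-1) (b := 2^-1)) => w.
    by rewrite cosB cosD; lra.
Qed.

Let Lsub f (tf : trig f) : L1t f := L1cl_sub P trig_bmeas tf.

Lemma L1t_exp f n : L1t f -> L1t (fun w => f w ^+ n).
Proof.
move=> Lf; elim: n => [|n IH].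
  by under eq_fun do rewrite expr0; exact/Lsub/trig1.
by under eq_fun do rewrite exprS; exact: (L1cl_mul trig_bmeas trig_mul).
Qed.

Lemma L1t_step f : L1t f -> (forall w, 0 <= f w <= 1) ->
  L1t (fun w => (f w < 2^-1)%R%:R).
Proof.
move=> Lf f01; apply: (@L1cl_lim _ _ _ P _ trig_bmeas (fun n w => step_poly n (f w)) _ 1).
- by move=> n; apply: L1t_exp; apply: (L1cl_compl trig_compl); exact: L1t_exp.
- by move=> n w; have /andP[q0 q1] := step_poly_itv n (f01 w); rewrite ger0_norm.
- by move=> w; exact: cvg_step_poly.
Qed.

Lemma L1t_sin_gt Y (c : R) : Lin Y -> -1 <= c <= 1 -> L1t (fun w => (c < sin (Y w))%R%:R).
Proof.
move=> LY /andP[c1 c2].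
(* The affine map sends [c < sin] to a value below [1/2], and its range lies in [[0, 1]] because
   both [c] and the sine lie in [[-1, 1]]. *)
have -> : (fun w => (c < sin (Y w))%R%:R) =
    fun w => ((2^-1 + c / 4) * 1 + (- 4^-1) * sin (Y w) < 2^-1)%R%:R :> R.
  by apply/funext => w; congr (nat_of_bool _)%:R; apply/idP/idP; lra.
apply: L1t_step; first by apply/Lsub/trig_lin; [exact: trig1|exact: trig_sin].
by move=> w; have := sin_le1 (Y w); have := sin_geN1 (Y w); lra.
Qed.

(** After division by a large [n + 1], both [a] and [X_t] fall into [[- pi / 2, pi / 2]], where the
    sine is increasing, so comparing sines eventually compares [a] with [X_t]. *)
Lemma L1t_ray t (a : R) : TT t -> L1t (\1_((X0 \o theta t) @^-1` `]a, +oo[)).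
Proof.
move=> Tt; pose f_ (n : nat) w : R := (sin (a / n.+1%:R) < sin (X0 (theta t w) / n.+1%:R))%R%:R.
apply: (@L1cl_lim _ _ _ P _ trig_bmeas f_ _ 1).
- move=> n; rewrite /f_.
  under eq_fun do rewrite [X0 _ / _]mulrC.
  by apply: L1t_sin_gt; [exact/LinZ/LinX|rewrite sin_geN1 sin_le1].
- by move=> n w; rewrite ger0_norm// lern1 leq_b1.
- move=> w; apply: cvg_near_cst; near=> n.
  have small (x : R) : `|x| <= n.+1%:R -> x / n.+1%:R \in `[- (pi / 2), pi / 2].
    move=> xn; rewrite in_itv/= -ler_norml normrM normfV [`|n.+1%:R|]ger0_norm//.
    apply: (@le_trans _ _ 1); first by rewrite ler_pdivrMr// mul1r.
    by rewrite ler_pdivlMr// mul1r pi_ge2.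
  have an : `|a| <= n.+1%:R.
    by near: n; exists (Num.truncn `|a|) => // n /= an; apply/ltW/(lt_le_trans (truncnS_gt _)); rewrite ler_nat.
  have Xn : `|X0 (theta t w)| <= n.+1%:R.
    by near: n; exists (Num.truncn `|X0 (theta t w)|) => // n /= an; apply/ltW/(lt_le_trans (truncnS_gt _)); rewrite ler_nat.
  rewrite /f_ ltr_sin ?small// ltr_pM2r ?invr_gt0// indicE; congr (nat_of_bool _)%:R.
  apply/idP/idP; rewrite inE/= in_itv/= andbT//.
Unshelve. all: by end_near. Qed.

Lemma L1t_indic A : SX A -> L1t (\1_A).
Proof.
move=> /SX_rays.
apply: (L1cl_sigma_algebra trig_bmeas trig1 trig_compl trig_mul).
by move=> _ [t Tt [q _ <-]]; exact: L1t_ray.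
Qed.

End TrigClosure.

(** * Separability and the main theorem *)

Section Separability.
Variables (R : realType) (disc : bool) (d : nat).
Variables (dO : measure_display) (Omega : measurableType dO).
Variables (P : probability Omega R) (X0 : Omega -> R).
Variable theta : 'rV[R]_d -> Omega -> Omega.
Hypothesis act : mp_action disc P theta.
Hypothesis mX0 : measurable_fun setT X0.
Hypothesis mfield : ~~ disc -> measurable_field X0 theta.

Local Notation TT := (@Tset R disc d).
Local Notation Bor := (g_sigma_algebraType (@rects R d)).
Local Notation SX := (sigmaX disc X0 theta).
Local Notation Ex := (expec P).
Local Notation bmeas := (@bounded_meas R dO Omega).

Lemma merge_families (I : countType) (F : I -> nat -> set Omega) :
  (forall i k, measurable (F i k)) ->
  exists G : nat -> set Omega, (forall k, measurable (G k)) /\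
    forall i, <<s range (F i) >> `<=` <<s range G >>.
Proof.
move=> mF; exists (fun k => if unpickle k is Some (i, j) then F i j else set0); split.
  by move=> k; case: unpickle => // -[].
move=> i; apply: smallest_sub; first exact: smallest_sigma_algebra.
move=> _ [j _ <-]; apply: sub_sigma_algebra.
by exists (pickle (i, j)) => //; rewrite pickleK.
Qed.

(* A measurable set of a product lies in the sigma-algebra of countably many
   rectangles, so its sections lie in one countably generated sigma-algebra. *)
Lemma sections_countably_generated (S : set (Bor * Omega)) : measurable S ->
  exists F : nat -> set Omega, (forall k, measurable (F k)) /\
    forall t : Bor, <<s range F >> [set w | S (t, w)].
Proof.
rewrite measurable_prod_measurableType.
suff sub : <<s [set A `*` B | A in @measurable _ Bor & B in @measurable _ Omega] >> `<=`
    [set S | exists F : nat -> set Omega, (forall k, measurable (F k)) /\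
      forall t : Bor, <<s range F >> [set w | S (t, w)]] by exact: sub.
apply: smallest_sub; first split => /=.
- exists (fun=> set0); split => // t.
  exact: (@measurable0 _ (g_sigma_algebraType (range (fun _ : nat => set0 : set Omega)))).
- move=> A [F [mF AF]]; exists F; split => // t.
  have := @measurableC _ (g_sigma_algebraType (range F)) _ (AF t).
  by congr (<<s _ >> _); apply/seteqP; split => w //= -[].
- move=> A /choice[F FP].
  have [G [mG GP]] := @merge_families nat F (fun i => (FP i).1).
  exists G; split => // t.
  rewrite (_ : [set _ | _] = \bigcup_n [set w | A n (t, w)]).
    apply: (@bigcup_measurable _ (g_sigma_algebraType (range G))) => n _.
    by apply: (GP n); exact: (FP n).2.
  by apply/seteqP; split => w.
- move=> _ [A mA [B mB <-]]; exists (fun=> B); split => // t.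
  have [At|At] := pselect (A t).
    apply: sub_sigma_algebra; exists 0%N => //.
    by apply/seteqP; split => w //= -[].
  rewrite (_ : [set _ | _] = set0); last by apply/seteqP; split => w //= -[].
  exact: (@measurable0 _ (g_sigma_algebraType (range (fun _ : nat => B)))).
Qed.

(** In discrete time the rays can be enumerated along the lattice. In continuous time they are the
    sections of one jointly measurable set. *)
Lemma ray_countably_generated (q : rat) : exists F : nat -> set Omega,
  (forall k, measurable (F k)) /\
  forall t, TT t -> <<s range F >> ((X0 \o theta t) @^-1` `]ratr q, +oo[).
Proof.
have mX t : TT t -> measurable ((X0 \o theta t) @^-1` `]ratr q, +oo[).
  move=> Tt; rewrite -[X in measurable X]setTI.
  by apply: (measurableT_comp mX0 (measurable_theta act Tt)).
have [dt|nd] : disc \/ ~~ disc by case: (disc); [left|right].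
  have /countable_injP[f finj] : countable TT by rewrite /Tset dt; exact: countable_int_rV.
  (* Inverse of the injection [f] of the lattice into [nat]. The default [0] is a lattice point, so
     every [e k] is one. *)
  pose e k := xget 0 [set t | TT t /\ f t = k].
  have eT k : TT (e k) by rewrite /e; case: xgetP => [t _ []//|_]; exact: Tset0.
  have eK t : TT t -> e (f t) = t.
    move=> Tt; rewrite /e; case: xgetP => [s _ [Ts fst]|/(_ t)]; last by case.
    by apply: finj; rewrite ?inE.
  exists (fun k => (X0 \o theta (e k)) @^-1` `]ratr q, +oo[); split.
    by move=> k; exact: mX.
  by move=> t Tt; apply: sub_sigma_algebra; exists (f t) => //; rewrite eK.
have mS : measurable [set p : Bor * Omega | (`]ratr q, +oo[%classic : set R) (X0 (theta p.1 p.2))].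
  have mI : measurable (`]ratr q, +oo[%classic : set R) by exact: measurable_itv.
  by rewrite measurable_prod_measurableType; exact: (mfield nd mI).
by have [F [mF FP]] := sections_countably_generated mS; exists F; split => // t _; exact: FP.
Qed.

Lemma sigmaX_countably_generated : exists F : nat -> set Omega,
  (forall k, measurable (F k)) /\ SX `<=` <<s range F >>.
Proof.
have /choice[F FP] := ray_countably_generated.
have [G [mG GP]] := @merge_families rat F (fun q => (FP q).1).
exists G; split => //; apply: subset_trans; first exact: SX_rays.
apply: smallest_sub; first exact: smallest_sigma_algebra.
by move=> _ [t Tt [q _ <-]]; apply: (GP q); exact: (FP q).2.
Qed.

Section Programs.
Variable F : nat -> set Omega.
Hypothesis mF : forall k, measurable (F k).

(* Stack programs over nat: 0 replaces the two top entries f, g by 1 - f * g,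
   1 pushes the constant 1, and k + 2 pushes the indicator of F k. *)
Definition exec (s : seq (Omega -> R)) (c : nat) : seq (Omega -> R) :=
  match c with
  | 0 => if s is f :: g :: s' then (fun w => 1 - f w * g w) :: s' else s
  | 1 => (fun=> 1) :: s
  | k.+2 => (\1_(F k) : Omega -> R) :: s
  end.

(** Quantifying over the stack below makes programs compose by concatenation. Programs are lists of
    numbers, so the computed functions form a countable class. *)
Definition computes (p : seq nat) (f : Omega -> R) : Prop :=
  forall s, foldl exec s p = f :: s.

Lemma computes_inj p f g : computes p f -> computes p g -> f = g.
Proof. by move=> pf pg; have := pf [::]; rewrite pg => -[]. Qed.

Definition computable : set (Omega -> R) := [set f | exists p, computes p f].

Lemma computable_nand f g : computable f -> computable g ->
  computable (fun w => 1 - f w * g w).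
Proof.
move=> [p pf] [q qg]; exists (q ++ p ++ [:: 0%N]) => s.
by rewrite !foldl_cat qg pf.
Qed.

Lemma computable1 : computable (fun=> 1).
Proof. by exists [:: 1%N]. Qed.

Lemma computable_indic k : computable (\1_(F k)).
Proof. by exists [:: k.+2]. Qed.

Lemma computable_compl f : computable f -> computable (fun w => 1 - f w).
Proof.
move=> cf; have := computable_nand cf computable1.
by congr computable; apply/funext => w; rewrite mulr1.
Qed.

Lemma computable_mul f g : computable f -> computable g -> computable (fun w => f w * g w).
Proof.
move=> cf cg; have := computable_compl (computable_nand cf cg).
by congr computable; apply/funext => w; rewrite opprB addrC subrK.
Qed.

Lemma computable_bmeas : computable `<=` bmeas.
Proof.
move=> f [p pf]; have : forall h, List.In h (foldl exec [::] p) -> bmeas h.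
  have : forall h : Omega -> R, List.In h [::] -> bmeas h by [].
  elim: p [::] {pf} => [//|c p IH] s sb; apply: IH => h; case: c => [|[|k]] /=.
  - case: s sb => [|u [|v s]] sb //=; [by apply: sb|].
    move=> [<-|hs]; last by apply: sb; right; right.
    apply: bmeasB; first exact: bmeas_cst.
    by apply: bmeasM; apply: sb; [left|right; left].
  - by move=> [<-|/sb//]; exact: bmeas_cst.
  - by move=> [<-|/sb//]; exact: bmeas_indic.
by rewrite pf; apply; left.
Qed.

End Programs.

(** Computed functions approximate the indicators of [sigma_X] but need not be such indicators
    themselves. So each pair of a program and a precision picks, if possible, one set of [sigma_X]
    that close to the computed function; when [A] qualifies, the picked set is within twice the
    precision of [A]. *)
Lemma sigmaX_separable : exists S : nat -> set Omega, (forall k, SX (S k)) /\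
  forall A, SX A -> forall e, 0 < e ->
    exists k, Ex (fun w => `|\1_A w - \1_(S k) w|) <= e.
Proof.
have [F [mF SF]] := sigmaX_countably_generated.
pose good (i : seq nat * nat) (S : set Omega) :=
  SX S /\ exists2 f, computes F i.1 f & Ex (fun w => `|\1_S w - f w|) <= i.2.+1%:R^-1.
have SX0 : SX set0 by exact: (@measurable0 _ (g_sigma_algebraType (gensX disc X0 theta))).
(* The default [set0] lies in [sigma_X], so [S k] does for every [k], whether or not it codes a
   pair. *)
pose S k := if unpickle k is Some i then xget set0 (good i) else set0.
exists S; split.
  by move=> k; rewrite /S; case: unpickle => // i; case: xgetP => // B _ [].
move=> A SA e e0.
have [n ne] : exists n : nat, n.+1%:R^-1 <= e / 2.
  exists (Num.truncn (e / 2)^-1); rewrite invf_ple ?posrE ?divr_gt0//.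
  exact/ltW/truncnS_gt.
have [bA cA] : L1cl P (computable F) (\1_A).
  apply: (L1cl_sigma_algebra (computable_bmeas mF) (computable1 F)
    (@computable_compl F) (@computable_mul F)) (SF _ SA).
  move=> _ [k _ <-]; apply: (L1cl_sub _ (computable_bmeas mF)); exact: computable_indic.
have [f [p pf] Af] := cA n.+1%:R^-1 ltac:(by []).
exists (pickle (p, n)); rewrite /S pickleK.
case: xgetP => [B _ [SB [g pg Bg]]|/(_ A)]; last by case; split => //; exists f.
have gf := computes_inj pg pf; rewrite {}gf in pg Bg.
have bf : bmeas f by apply: (computable_bmeas mF); exists p.
have bB : bmeas (\1_B) by exact: (bmeas_indic R (SX_measurable act mX0 SB)).
apply: (le_trans (Ex_dist3 P bA bf bB)); rewrite [leRHS](splitr e); apply: lerD.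
  exact: le_trans ne.
under [X in expec P X]eq_fun do rewrite distrC.
exact: le_trans ne.
Qed.

End Separability.

(** * The equivalence of ergodicity and weak mixing *)

Section Main.
Variables (R : realType) (alpha : R) (disc : bool) (d : nat).
Variables (dO : measure_display) (Omega : measurableType dO).
Variables (P : probability Omega R) (X0 : Omega -> R).
Variable theta : 'rV[R]_d -> Omega -> Omega.
Hypothesis act : mp_action disc P theta.
Hypothesis sas : SaS_field alpha disc P X0 theta.
Hypothesis mfield : ~~ disc -> measurable_field X0 theta.

Local Notation TT := (@Tset R disc d).
Local Notation SX := (sigmaX disc X0 theta).
Local Notation corr := (covar P theta).
Local Notation wnull := (@wnull R disc d).
Let mX0 : measurable_fun setT X0 := sas.1.

Lemma indic_le1 (A : set Omega) w : `|\1_A w : R| <= 1.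
Proof. by rewrite indicE ger0_norm// lern1 leq_b1. Qed.

Lemma P_image_corr A B t : SX A -> SX B -> TT t ->
  P (A `&` theta t @` B) = (P A * P B + (corr (\1_A) (\1_B) t)%:E)%E.
Proof.
move=> SA SB Tt; rewrite (P_image act mX0)//.
have mA := SX_measurable act mX0 SA; have mB := SX_measurable act mX0 SB.
rewrite -(fineK (fin_num_measure P _ mA)) -(fineK (fin_num_measure P _ mB)).
by rewrite -EFinM -EFinD /covar !Ex_indic// addrC subrK.
Qed.

Lemma strong_indic : 0 < alpha -> ergodic disc P X0 theta ->
  forall A B, SX A -> SX B -> strong disc P theta (\1_A) (\1_B).
Proof.
move=> alpha0 erg A B SA SB.
apply: (strong_approx alpha0 act sas mfield erg).
- exact: sbm_indic.
- exact: sbm_indic.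
- exact: (L1t_indic act mX0 SA).2.
- exact: (L1t_indic act mX0 SB).2.
Qed.

Lemma ergodic_weakly_mixing : 0 < alpha ->
  ergodic disc P X0 theta -> weakly_mixing disc P X0 theta.
Proof.
move=> alpha0 erg.
have [S [SS Sdense]] := sigmaX_separable act mX0 mfield.
pose F (j : nat) t : R :=
  if (unpickle j : option (nat * nat)) is Some (k, l)
  then `|corr (\1_(S k)) (\1_(S l)) t| else 0.
have [] := @koopman_von_neumann R disc d F.
- move=> j; rewrite /F; case: unpickle => [[k l]|]; last exact: adm_cst.
  by apply/adm_norm/(adm_corr act mX0 mfield); exact: sbm_indic.
- by move=> j t; rewrite /F; case: unpickle => [[k l]|].
- move=> j; rewrite /F; case: unpickle => [[k l]|]; first exact: strong_indic.
  by apply: wnull_zero => //; exact: adm_cst.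
move=> D [DT bD D1 DF]; exists D; split => // A B SA SB tn Dtn tnoo.
have sA := sbm_indic SA; have sB := sbm_indic SB.
suff cvg0 : corr (\1_A) (\1_B) (tn n) @[n --> \oo] --> (0 : R).
  have -> : (fun n => P (A `&` theta (tn n) @` B)) =
      (fun n => P A * P B + (corr (\1_A) (\1_B) (tn n))%:E)%E.
    by apply/funext => n; apply: P_image_corr => //; exact: DT.
  have cvgD0 : (P A * P B + (corr (\1_A) (\1_B) (tn n))%:E)%E @[n --> \oo]
      --> (P A * P B + 0)%E.
    apply: cvgeD; [by rewrite fin_num_adde_defl|exact: cvg_cst|].
    by apply: cvg_EFin => //; near=> n.
  by rewrite adde0 in cvgD0.
apply/cvgrPdist_le => e e0.
(* Each replacement of a set by an approximant costs [2 * (e / 8)]; the two together take [e / 2],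
   and the correlation of the approximants the other half. *)
have e8 : 0 < e / 8 by rewrite divr_gt0.
have [k Ak] := Sdense A SA _ e8; have [l Bl] := Sdense B SB _ e8.
have sk := sbm_indic (SS k); have sl := sbm_indic (SS l).
have e2 : 0 < e / 2 by rewrite divr_gt0.
have [M HM] := DF (pickle (k, l)) _ e2.
near=> n; rewrite sub0r normrN.
have Tn := DT _ (Dtn n).
have : F (pickle (k, l)) (tn n) < e / 2.
  apply: HM => //; near: n.
  by move/cvgryPgt : tnoo => /(_ M).
rewrite /F pickleK.
have := corr_bound act mX0 (sbmB sA sk) sB Tn ler01 (indic_le1 B) Ak.
rewrite -(corr_subl act sas)//.
have := corr_boundr act mX0 sk (sbmB sB sl) Tn ler01 (indic_le1 (S k)) Bl.
rewrite -(corr_subr act sas)//.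
move: (corr _ _ _) (corr _ _ _) (corr _ _ _) => a b c.
rewrite !ler_norml ltr_norml; lra.
Unshelve. all: by end_near. Qed.

(** Far out along [D] the correlations are at most [e]; the remaining times lie off [D] or in a
    ball, both null in mean. So the absolute correlation is at most [e] plus a null function. *)
Lemma weakly_mixing_ergodic : (0 < d)%N ->
  weakly_mixing disc P X0 theta -> ergodic disc P X0 theta.
Proof.
move=> d0 [D [DT bD D1 Dmix]]; apply/(ergodicP act mX0 mfield) => A B SA SB.
have sA := sbm_indic SA; have sB := sbm_indic SB.
have ac := adm_corr act mX0 mfield sA sB.
have sup_ge0 (t : 'rV[R]_d) : 0 <= supnorm t by exact: le_trans (supnorm_entry _ (Ordinal d0)).
suff : wnull (fun t => `|corr (\1_A) (\1_B) t|).
  by apply: wnull_le => //; exact: adm_norm.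
apply: wnull_excess => // e e0.
(* Otherwise every [n] gives a point of [D] of norm above [n] with correlation above [e], and this
   sequence contradicts mixing along [D]. *)
have [M M0 HM] : exists2 M, 0 <= M & forall t, D t -> M < supnorm t ->
    `|corr (\1_A) (\1_B) t| <= e.
  apply: contrapT => nM.
  have /choice[tn tnP] (n : nat) : exists t, [/\ D t, n%:R < supnorm t &
      e < `|corr (\1_A) (\1_B) t|].
    apply: contrapT => nt; apply: nM; exists n%:R => // t Dt nt'.
    by rewrite leNgt; apply/negP => et; apply: nt; exists t.
  have Dtn n : D (tn n) by have [] := tnP n.
  have tnoo : supnorm (tn n) @[n --> \oo] --> +oo.
    apply/cvgryPge => x; near=> n; apply: (@le_trans _ _ n%:R).
      by near: n; exact: nbhs_infty_ger.
    by have [_ /ltW] := tnP n.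
  have := Dmix A B SA SB tn Dtn tnoo.
  under eq_fun do rewrite (P_image_corr SA SB (DT _ (Dtn _))).
  have mA := SX_measurable act mX0 SA; have mB := SX_measurable act mX0 SB.
  rewrite -(fineK (fin_num_measure P _ mA)) -(fineK (fin_num_measure P _ mB)) -EFinM.
  move=> /fine_cvgP[_ /cvgrPdist_lt /(_ e e0)[n _ /(_ n (leqnn n))]] /=.
  rewrite opprD addrA subrr add0r normrN => ce.
  by have [_ _ /lt_trans/(_ ce)] := tnP n; rewrite ltxx.
have nTD : wnull (\1_(TT `\` D)) by exact/density_oneP.
have aTD : adm disc (\1_(TT `\` D)).
  by apply: adm_indic => _; exact: borel_TsetD.
have aB : adm disc (\1_[set t : 'rV[R]_d | supnorm t <= M]).
  by apply: adm_indic => _; exact: borel_ball.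
have nB := ball_wnull disc d0 M0.
(* The factor [2] is the trivial bound for a correlation of two indicators. *)
exists (fun t => 2 * \1_(TT `\` D) t + 2 * \1_[set t : 'rV[R]_d | supnorm t <= M] t); split.
- by apply: admD; exact: admZ.
- exact: wnull_lin.
- by move=> t; rewrite addr_ge0// mulr_ge0.
move=> t Tt.
have c2 : `|corr (\1_A) (\1_B) t| <= 2.
  have := corr_bound act mX0 sA sB Tt ler01 (indic_le1 B) (c := 1).
  rewrite !mulr1; apply; rewrite -[leRHS](Ex_cst P); apply: Ex_le.
  + exact/bmeas_norm/(sbm_bmeas act mX0).
  + exact: bmeas_cst.
  + exact: indic_le1.
have ind0 (C : set 'rV[R]_d) : 0 <= \1_C t :> R by rewrite indicE.
have [tM|Mt] := leP (supnorm t) M.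
  have -> : \1_[set t : 'rV[R]_d | supnorm t <= M] t = 1 :> R by rewrite indicE mem_set.
  by have := ind0 (TT `\` D); lra.
have [Dt|nDt] := pselect (D t).
  apply: (le_trans (HM t Dt Mt)); rewrite lerDl addr_ge0// mulr_ge0//.
have -> : \1_(TT `\` D) t = 1 :> R by rewrite indicE mem_set.
by have := ind0 [set t : 'rV[R]_d | supnorm t <= M]; lra.
Unshelve. all: by end_near. Qed.

End Main.

(* disc = true : T = Z ;  disc = false : T = R *)
Theorem mainTheorem9 (R : realType) (alpha : R) (disc : bool) (d : nat)
  (dO : measure_display) (Omega : measurableType dO)
  (P : probability Omega R) (X0 : Omega -> R)
  (theta : 'rV[R]_d -> Omega -> Omega) :
  0 < alpha < 2 -> (0 < d)%N ->
  mp_action disc P theta ->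
  SaS_field alpha disc P X0 theta ->
  (~~ disc -> measurable_field X0 theta) ->
  (ergodic disc P X0 theta <-> weakly_mixing disc P X0 theta).
Proof.
move=> /andP[alpha0 _] d0 act sas mfield; split.
  exact: (ergodic_weakly_mixing act sas mfield alpha0).
exact: (weakly_mixing_ergodic act sas mfield d0).
Qed.
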